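(* Let $2\leq d\leq\infty$, and let $G_1,G_2\leq\mathrm{Isom}(\mathbb{H}^d)$ be strongly discrete groups whose limit sets are equal, i.e. $\Lambda(G_1)=\Lambda(G_2)$. If $G_1$ is nonelementary and geometrically finite and is a subgroup of $G_2$, then $G_1$ and $G_2$ are commensurable.
   Context: For $2\leq d\leq\infty$, $\mathbb{H}^d$ denotes $d$-dimensional real hyperbolic space ($\mathbb{H}^\infty$ being the infinite-dimensional real hyperbolic space modelled on a separable infinite-dimensional Hilbert space), with hyperbolic metric $\mathrm{dist}$, boundary at infinity $\partial\mathbb{H}^d$, isometry group $\mathrm{Isom}(\mathbb{H}^d)$, and a fixed basepoint $\mathbf{0}\in\mathbb{H}^d$. $B(\mathbf{0},\sigma)$ is the ball of radius $\sigma$ about $\mathbf{0}$, and for a set $A$, $G(A)=\bigcup_{g\in G}g(A)$. A group $G\leq\mathrm{Isom}(\mathbb{H}^d)$ is strongly discrete if $\#\{g\in G:\mathrm{dist}(\mathbf{0},g(\mathbf{0}))\leq R\}<\infty$ for all $R>0$. The limit set of $G$ is $\Lambda(G)=\{\xi\in\partial\mathbb{H}^d:\ \text{there is a sequence } (g_n)_{n\ge 1} \text{ in } G \text{ with } g_n(\mathbf{0})\to\xi\}$. $G$ is nonelementary if $\Lambda(G)$ contains at least three points. A set $A\subset\mathbb{H}^d$ is convex if it contains the geodesic segment connecting any two of its points. For $G$ nonelementary, $\mathcal{C}(G)$ denotes the convex hull of the limit set: the smallest closed convex subset of $\mathbb{H}^d$ whose closure in $\mathbb{H}^d\cup\partial\mathbb{H}^d$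 contains $\Lambda(G)$. A strongly discrete group $G\leq\mathrm{Isom}(\mathbb{H}^d)$ is geometrically finite if there exist a disjoint $G$-invariant collection $\mathscr{H}$ of horoballs and a radius $\sigma>0$ such that $\mathcal{C}(G)\subset G(B(\mathbf{0},\sigma))\cup\bigcup_{H\in\mathscr{H}}H$. Two groups $G_1,G_2$ are commensurable if $G_1\cap G_2$ has finite index in both $G_1$ and $G_2$. *)

(* Defs.v *)
From HB Require Import structures.
From mathcomp Require Import all_boot all_order all_algebra.
From mathcomp Require Import all_classical all_reals all_analysis.
Set Implicit Arguments.
Unset Strict Implicit.
Unset Printing Implicit Defensive.
Import Order.TTheory GRing.Theory Num.Theory.
Import numFieldNormedType.Exports.
Local Open Scope classical_set_scope.
Local Open Scope ring_scope.

Variant dimension := FinDim of nat | InfDim.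

Definition dim_ge (d : dimension) (n : nat) : bool :=
  if d is FinDim m then (n <= m)%N else true.

Section HyperbolicSpace.
Variables (R : realType) (d : dimension).
Implicit Types (u v : nat -> R).

(* The Hilbert space l^2 of dimension d: square-summable real sequences, all of
   whose coordinates of index i >= d vanish.  It is R^d for d finite. *)
Definition in_l2 u : Prop :=
  (forall i, ~~ dim_ge d i.+1 -> u i = 0) /\
  cvgn (series (fun i => u i ^+ 2)).

Definition dotp u v : R := limn (series (fun i => u i * v i)).

Definition norm2 u : R := Num.sqrt (dotp u u).

Definition dist2 u v : R := norm2 (fun i => u i - v i).

(* Projective (Beltrami-Klein) model of H^d: a point of the hyperboloid, or an
   isotropic line, is represented by its multiple (1, u); points of H^d then
   correspond to the u with |u| < 1 and points at infinity to those with
   |u| = 1. *)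
Record hyp := Hyp {
  hyp_val :> nat -> R;
  hyp_l2 : in_l2 hyp_val;
  hyp_lt1 : norm2 hyp_val < 1 }.

Record bdry := Bdry {
  bdry_val :> nat -> R;
  bdry_l2 : in_l2 bdry_val;
  bdry_eq1 : norm2 bdry_val = 1 }.

Definition arcosh (c : R) : R := ln (c + Num.sqrt (c ^+ 2 - 1)).

(* cosh dist([X], [Y]) = |Q(X, Y)| / sqrt (Q(X, X) Q(Y, Y)) for the Lorentzian
   form Q, evaluated at X = (1, x) and Y = (1, y). *)
Definition hdist (x y : hyp) : R :=
  arcosh ((1 - dotp x y) /
          (Num.sqrt (1 - dotp x x) * Num.sqrt (1 - dotp y y))).

Definition hball (o : hyp) (r : R) : set hyp := [set x | hdist o x < r].

Definition hclosed (A : set hyp) : Prop :=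
  forall x, (forall e, 0 < e -> A `&` hball x e !=set0) -> A x.

(* Trace on H^d of the neighbourhood filter of xi in the union of H^d and its
   boundary, whose topology is the norm topology of the closed unit ball. *)
Definition at_bdry (xi : bdry) : set_system hyp :=
  filter_from [set e : R | 0 < e] (fun e => [set x : hyp | dist2 x xi < e]).

Definition bdry_closure (A : set hyp) : set bdry :=
  [set xi | forall U, at_bdry xi U -> A `&` U !=set0].

Definition geodesic_path (x y : hyp) (c : R -> hyp) : Prop :=
  [/\ c 0 = x, c (hdist x y) = y &
      forall s t, 0 <= s <= hdist x y -> 0 <= t <= hdist x y ->
        hdist (c s) (c t) = `|s - t| ].

Definition hconvex (A : set hyp) : Prop :=
  forall x y c, A x -> A y -> geodesic_path x y c ->
    forall t, 0 <= t <= hdist x y -> A (c t).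

(* Surjectivity is not automatic when d is infinite. *)
Definition isometry (g : hyp -> hyp) : Prop :=
  bijective g /\ forall x y, hdist (g x) (g y) = hdist x y.

Definition isometry_group (G : set (hyp -> hyp)) : Prop :=
  [/\ G `<=` isometry,
      G id,
      forall g h, G g -> G h -> G (g \o h) &
      forall g, G g -> exists h, [/\ G h, cancel g h & cancel h g] ].

Definition strongly_discrete (o : hyp) (G : set (hyp -> hyp)) : Prop :=
  forall r : R, 0 < r -> finite_set [set g | G g /\ hdist o (g o) <= r].

Definition limit_set (o : hyp) (G : set (hyp -> hyp)) : set bdry :=
  [set xi | exists g : nat -> hyp -> hyp,
     (forall n, G (g n)) /\ (fun n => g n o) @ \oo --> at_bdry xi].

Definition nonelementary (o : hyp) (G : set (hyp -> hyp)) : Prop :=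
  exists xi eta zeta : bdry,
    [/\ limit_set o G xi, limit_set o G eta & limit_set o G zeta] /\
    [/\ xi <> eta, xi <> zeta & eta <> zeta].

(* C is the smallest closed convex subset of H^d whose closure in the union of
   H^d and its boundary contains L. *)
Definition is_convex_hull (L : set bdry) (C : set hyp) : Prop :=
  [/\ hclosed C, hconvex C, L `<=` bdry_closure C &
      forall A, hclosed A -> hconvex A -> L `<=` bdry_closure A -> C `<=` A].

Definition busemann (xi : bdry) (o x : hyp) : R :=
  lim ((fun y => hdist x y - hdist o y) @ at_bdry xi).

(* Open horoballs are the strict sublevel sets of Busemann functions; changing
   o only shifts t. *)
Definition horoball (o : hyp) (B : set hyp) : Prop :=
  exists xi t, B = [set x | busemann xi o x < t].

Definition geometrically_finite (o : hyp) (G : set (hyp -> hyp)) : Prop :=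
  exists2 C, is_convex_hull (limit_set o G) C &
  exists (HH : set (set hyp)) (sigma : R),
    [/\ HH `<=` horoball o,
        trivIset HH id,
        forall g B, G g -> HH B -> HH (g @` B),
        0 < sigma &
        C `<=` (\bigcup_(g in G) (g @` hball o sigma)) `|`
               (\bigcup_(B in HH) B) ].

Definition lcosets (K G : set (hyp -> hyp)) : set (set (hyp -> hyp)) :=
  [set [set g \o k | k in K] | g in G].

Definition commensurable (G1 G2 : set (hyp -> hyp)) : Prop :=
  finite_set (lcosets (G1 `&` G2) G1) /\ finite_set (lcosets (G1 `&` G2) G2).

End HyperbolicSpace.

(* Main.v *)
Require Import Defs.
From HB Require Import structures.
From mathcomp Require Import all_boot all_order all_algebra.
From mathcomp Require Import all_classical all_reals all_analysis.
From mathcomp Require Import ring lra zify.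
Import Order.TTheory GRing.Theory Num.Theory.
Import numFieldNormedType.Exports.
Local Open Scope classical_set_scope.
Local Open Scope ring_scope.

(* The convex hull C of the common limit set is invariant under G2, so an orbit
   G2 p with p in C stays in C.  If this orbit meets the horoballs only at bounded
   depth, every orbit point is within bounded distance of G1 p, because in at least
   one of three fixed directions a geodesic of C leaves the horoball nearby, at a
   point of G1 B(o, sigma); strong discreteness of G2 then bounds the index.

   Suppose the depth is unbounded.  From one deep orbit point, geodesics towards
   all other deep horoballs touching p leave its horoball (except for one
   direction) at bounded distance and far apart, so by discreteness only finitely
   many deep horoballs touch p.  Hence some horoball H touching p contains orbit
   points of unbounded depth close to a ray from p, and the stabilizer of H in G1
   is infinite.  Its elements move a sufficiently deep point g p of that ray by a
   bounded amount; conjugating by g contradicts strong discreteness of G2.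

   Only coarse geometry is needed: with c = cosh dist everything follows from the
   four-point inequality c(x,z) c(y,w) <= 2 (c(x,y) c(z,w) + c(y,z) c(x,w)) and its
   analogue with w at infinity. *)

(** The obstacle is twofold. The family of horoballs is invariant under [G1] only, so [G2] may throw
    an orbit point anywhere into a horoball and depth has to be controlled by hand. And [d] may be
    infinite, so bounded sets need not be relatively compact: finiteness comes only from counting
    the elements of [G2] that move [p] by a bounded amount.

    Why the stabilizer is infinite: let [b] be the exponential of a Busemann function, scaled so
    that the horoball is [b < 1]. From a point with [b = eps], geodesics in good directions leave at
    cosh-distance about [1 / eps], and two exits are about [1 / eps^2] apart. Both are near [G1 p],
    so deep points of [H] produce infinitely many [k] in [G1] with [k p] near the horosphere of [H].
    The pullbacks of [H] by these [k] are deep horoballs touching [p]; there are finitely many, so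
    infinitely many [k] share a pullback, and their quotients preserve [H].

    The Klein model is used because its geodesics are affine segments and its closed ball sits in a
    complete space for every [d]. *)

Set Implicit Arguments.
Unset Strict Implicit.
Unset Printing Implicit Defensive.

(** * Square-summable sequences *)

Section L2.
Context (R : realType) (d : dimension).
Implicit Types u v w : nat -> R.

Lemma is_cvg_dotp u v : in_l2 d u -> in_l2 d v ->
  cvgn (series (fun i => u i * v i)).
Proof.
move=> [_ cu] [_ cv]; apply: normed_cvg.
apply: (@series_le_cvg _ _ (fun i => u i ^+ 2 + v i ^+ 2)) => [n|n|n|].
- exact: normr_ge0.
- by rewrite addr_ge0 ?sqr_ge0.
- have := sqr_ge0 (u n - v n); have := sqr_ge0 (u n + v n).
  by have := sqr_ge0 (u n); have := sqr_ge0 (v n); rewrite ler_norml; nra.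
- exact: (is_cvg_seriesD cu cv).
Qed.

Lemma in_l2_lin a u b v : in_l2 d u -> in_l2 d v ->
  in_l2 d (fun i => a * u i + b * v i).
Proof.
move=> lu lv; have [zu cu] := lu; have [zv cv] := lv; split=> [i di|].
  by rewrite zu ?zv// !mulr0 addr0.
apply: (@series_le_cvg _ _
  (fun i => (2 * a ^+ 2) * u i ^+ 2 + (2 * b ^+ 2) * v i ^+ 2)) => [n|n|n|].
- exact: sqr_ge0.
- by have := sqr_ge0 (a * u n); have := sqr_ge0 (b * v n); lra.
- by have := sqr_ge0 (a * u n - b * v n); lra.
- have -> : (fun i => 2 * a ^+ 2 * u i ^+ 2 + 2 * b ^+ 2 * v i ^+ 2) =
      (2 * a ^+ 2) *: (fun i => u i ^+ 2) + (2 * b ^+ 2) *: (fun i => v i ^+ 2).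
    by apply/funext.
  by apply: is_cvg_seriesD; apply: is_cvg_seriesZ.
Qed.

Lemma dotpC u v : dotp u v = dotp v u.
Proof. by rewrite /dotp; congr (limn (series _)); apply/funext=> i; exact: mulrC. Qed.

Lemma dotp_linl a u b v w : in_l2 d u -> in_l2 d v -> in_l2 d w ->
  dotp (fun i => a * u i + b * v i) w = a * dotp u w + b * dotp v w.
Proof.
move=> lu lv lw; have cu := is_cvg_dotp lu lw; have cv := is_cvg_dotp lv lw.
have -> : dotp (fun i => a * u i + b * v i) w =
    limn (series (a *: (fun i => u i * w i) + b *: (fun i => v i * w i))).
  congr (limn (series _)); apply/funext=> i.
  by rewrite mulrDl -!mulrA.
have ca : cvgn (series (a *: (fun i => u i * w i))) by apply: is_cvg_seriesZ.
have cb : cvgn (series (b *: (fun i => v i * w i))) by apply: is_cvg_seriesZ.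
by rewrite (lim_seriesD ca cb) !lim_seriesZ.
Qed.

Lemma dotp_linr a u b v w : in_l2 d u -> in_l2 d v -> in_l2 d w ->
  dotp w (fun i => a * u i + b * v i) = a * dotp w u + b * dotp w v.
Proof. by move=> lu lv lw; rewrite dotpC dotp_linl// !(dotpC _ w). Qed.

Lemma dotpuE u : dotp u u = limn (series (fun i => u i ^+ 2)).
Proof. by []. Qed.

Lemma series_sqr_le_dotp u n : in_l2 d u ->
  series (fun i => u i ^+ 2) n <= dotp u u.
Proof.
move=> [_ cu]; apply: nondecreasing_cvgn_le cu n.
by apply: nondecreasing_series => i _ _; exact: sqr_ge0.
Qed.

Lemma dotp_ge0 u : in_l2 d u -> 0 <= dotp u u.
Proof. by move=> lu; have := series_sqr_le_dotp 0 lu; rewrite /series/= big_geq. Qed.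

Lemma sqr_le_dotp u i : in_l2 d u -> u i ^+ 2 <= dotp u u.
Proof.
move=> lu; apply: le_trans (series_sqr_le_dotp i.+1 lu).
by rewrite /series/= big_nat_recr//= lerDr sumr_ge0// => j _; exact: sqr_ge0.
Qed.

Lemma dotp_cs u v : in_l2 d u -> in_l2 d v ->
  dotp u v ^+ 2 <= dotp u u * dotp v v.
Proof.
move=> lu lv.
have h a b : 0 <= a ^+ 2 * dotp u u + 2 * a * b * dotp u v + b ^+ 2 * dotp v v.
  have l := in_l2_lin a b lu lv.
  have := dotp_ge0 l; rewrite dotp_linl// !dotp_linr// (dotpC v u); lra.
have u0 := dotp_ge0 lu; have v0 := dotp_ge0 lv.
have [uz|un] := eqVneq (dotp u u) 0.
  have := h (- dotp v v * dotp u v - dotp u v) (dotp u v).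
  have := h (- (dotp v v + 1)) (dotp u v).
  by rewrite uz; nra.
have up : 0 < dotp u u by rewrite lt_def un.
have := h (- dotp u v) (dotp u u).
have -> : (- dotp u v) ^+ 2 * dotp u u + 2 * (- dotp u v) * dotp u u * dotp u v +
  dotp u u ^+ 2 * dotp v v = dotp u u * (dotp u u * dotp v v - dotp u v ^+ 2) by ring.
by rewrite pmulr_rge0// subr_ge0.
Qed.

Lemma norm2_sqr u : in_l2 d u -> norm2 u ^+ 2 = dotp u u.
Proof. by move=> lu; rewrite sqr_sqrtr// dotp_ge0. Qed.

Lemma dist2_lin u v : dist2 u v = norm2 (fun i => 1 * u i + (-1) * v i).
Proof. by congr norm2; apply/funext=> i; rewrite mul1r mulN1r. Qed.

Lemma in_l2B u v : in_l2 d u -> in_l2 d v -> in_l2 d (fun i => u i - v i).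
Proof.
move=> lu lv; have := in_l2_lin 1 (-1) lu lv; congr in_l2.
by apply/funext=> i; rewrite mul1r mulN1r.
Qed.

Lemma dist2_ge0 u v : 0 <= dist2 u v.
Proof. exact: sqrtr_ge0. Qed.

Lemma dist2_sqr u v : in_l2 d u -> in_l2 d v ->
  dist2 u v ^+ 2 = dotp u u - 2 * dotp u v + dotp v v.
Proof.
move=> lu lv; rewrite dist2_lin norm2_sqr; last exact: in_l2_lin.
have l := in_l2_lin 1 (-1) lu lv.
by rewrite dotp_linl// !dotp_linr// (dotpC v u); ring.
Qed.

Lemma dotpB_le u v w : in_l2 d u -> in_l2 d v -> in_l2 d w ->
  `|dotp w u - dotp w v| <= norm2 w * dist2 u v.
Proof.
move=> lu lv lw; rewrite dist2_lin.
have l := in_l2_lin 1 (-1) lu lv.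
have -> : dotp w u - dotp w v = dotp w (fun i => 1 * u i + (-1) * v i).
  by rewrite dotp_linr//; ring.
rewrite -ler_sqr ?nnegrE ?mulr_ge0 ?sqrtr_ge0// real_normK ?num_real//.
by rewrite exprMn !norm2_sqr//; exact: dotp_cs.
Qed.

Lemma dist2_triangle u v w : in_l2 d u -> in_l2 d v -> in_l2 d w ->
  dist2 u w <= dist2 u v + dist2 v w.
Proof.
move=> lu lv lw; have lx := in_l2B lu lv; have ly := in_l2B lv lw.
have e : (fun i => u i - w i) = (fun i => 1 * (u i - v i) + 1 * (v i - w i)).
  by apply/funext=> i; ring.
rewrite -ler_sqr ?nnegrE ?addr_ge0 ?dist2_ge0//.
rewrite [in leLHS]/dist2 e norm2_sqr; last exact: in_l2_lin.
rewrite dotp_linl ?dotp_linr//; last exact: in_l2_lin.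
rewrite sqrrD /dist2 !norm2_sqr//.
set x := (fun i => u i - v i) in lx *; set y := (fun i => v i - w i) in ly *.
have : dotp x y <= norm2 x * norm2 y.
  apply: le_trans (ler_norm _) _.
  rewrite -ler_sqr ?nnegrE ?mulr_ge0 ?sqrtr_ge0// real_normK ?num_real//.
  by rewrite exprMn !norm2_sqr//; exact: dotp_cs.
by rewrite (dotpC y x) mulr2n; lra.
Qed.

Lemma dist2C u v : dist2 u v = dist2 v u.
Proof.
rewrite /dist2 /norm2; congr (Num.sqrt (limn (series _))).
by apply/funext=> i; ring.
Qed.

Lemma in_l2_bounded u (M : R) : (forall i, ~~ dim_ge d i.+1 -> u i = 0) ->
  (forall n, series (fun i => u i ^+ 2) n <= M) ->
  in_l2 d u /\ dotp u u <= M.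
Proof.
move=> zu uM.
have cu : cvgn (series (fun i => u i ^+ 2)).
  apply: nondecreasing_is_cvgn; last by exists M => _ [n _ <-]; exact: uM.
  by apply: nondecreasing_series => i _ _; exact: sqr_ge0.
by split=> //; rewrite dotpuE; apply: limr_le => //; near=> n; exact: uM.
Unshelve. all: by end_near. Qed.

(** The limit is taken coordinatewise. The Cauchy bound survives on every finite partial sum, hence
    for the whole series of [f n - u]. Completeness stands in for compactness of the closed ball
    when [d] is infinite. *)
Lemma l2_complete (f : nat -> nat -> R) : (forall n, in_l2 d (f n)) ->
  (forall e, 0 < e -> exists N, forall n m, (N <= n)%N -> (N <= m)%N ->
     dist2 (f n) (f m) <= e) ->
  exists u, in_l2 d u /\
    forall e, 0 < e -> exists N, forall n, (N <= n)%N -> dist2 (f n) u <= e.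
Proof.
move=> lf cf.
have le n m i : `|f n i - f m i| <= dist2 (f n) (f m).
  rewrite -ler_sqr ?nnegrE ?dist2_ge0// real_normK ?num_real//.
  rewrite norm2_sqr; last exact: in_l2B.
  exact: (sqr_le_dotp i (in_l2B (lf n) (lf m))).
have cc i : cvgn (fun n => f n i).
  apply/cauchy_cvgP; apply: cauchy_exP => e e0.
  have [N hN] := cf (e / 2) ltac:(lra).
  exists (f N i); rewrite -ball_normE /=; exists N => // n /= Nn.
  by apply: le_lt_trans (le _ _ _) _; apply: le_lt_trans (hN _ _ (leqnn N) Nn) _; lra.
pose u i := limn (fun n => f n i).
have zu i : ~~ dim_ge d i.+1 -> u i = 0.
  move=> di; rewrite /u; have -> : (fun n => f n i) = (fun=> 0).
    by apply/funext => n; have [-> ] := lf n.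
  exact: lim_cst.
have key e N : (forall n m, (N <= n)%N -> (N <= m)%N -> dist2 (f n) (f m) <= e) ->
    forall n, (N <= n)%N -> in_l2 d (fun i => f n i - u i) /\
      dotp (fun i => f n i - u i) (fun i => f n i - u i) <= e ^+ 2.
  move=> hN n Nn; apply: in_l2_bounded => [i di|k].
    by rewrite zu//; have [-> ] := lf n; rewrite ?subr0.
  have h : (fun m => series (fun i => (f n i - f m i) ^+ 2) k) @ \oo -->
      series (fun i => (f n i - u i) ^+ 2) k.
    elim: k => [|k IH].
      have -> : (fun m => series (fun i => (f n i - f m i) ^+ 2) 0) = (fun=> 0).
        by apply/funext => m; rewrite /series/= big_geq.
      by rewrite /series/= big_geq//; exact: cvg_cst.
    have -> : (fun m => series (fun i => (f n i - f m i) ^+ 2) k.+1) =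
        (fun m => series (fun i => (f n i - f m i) ^+ 2) k + (f n k - f m k) ^+ 2).
      by apply/funext => m; rewrite seriesSr.
    rewrite seriesSr; apply: cvgD; first exact: IH.
    have c : (fun m => f n k - f m k) @ \oo --> f n k - u k.
      by apply: cvgB; [exact: cvg_cst|exact: cc].
    by rewrite expr2; under eq_fun do rewrite expr2; exact: cvgM.
  rewrite -(cvg_lim _ h)//; apply: limr_le; first by apply: cvgP h.
  exists N => // m Nm /=.
  apply: le_trans (series_sqr_le_dotp k (in_l2B (lf n) (lf m))) _.
  have e0 : 0 <= e by apply: le_trans (hN n m Nn Nm); exact: dist2_ge0.
  rewrite -norm2_sqr; last exact: in_l2B.
  by rewrite ler_sqr ?nnegrE ?sqrtr_ge0//; exact: hN.
exists u; split.
  have [N hN] := cf 1 ltr01.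
  have [h _] := key _ _ hN N (leqnn N).
  have := in_l2B (lf N) h; congr in_l2.
  by apply/funext=> i; ring.
move=> e e0; have [N hN] := cf e e0; exists N => n Nn.
have [h1 h2] := key _ _ hN n Nn.
rewrite -ler_sqr ?nnegrE ?dist2_ge0//; last exact: ltW.
by rewrite /dist2 (norm2_sqr h1).
Qed.

End L2.

(** * The Lorentz form and the four-point inequality *)

Section Kernel.
Context (R : realType) (d : dimension).
Implicit Types (u v : nat -> R) (x y z w : hyp R d) (xi : bdry R d).

(* The Lorentz form on the vectors (1, u) and (1, v). *)
Definition lker u v : R := 1 - dotp u v.

(** Covers interior and ideal points alike, so that each inequality on the Lorentz form is proved
    once for both. *)
Definition cball u : Prop := in_l2 d u /\ 0 <= lker u u.

Lemma lkerC u v : lker u v = lker v u.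
Proof. by rewrite /lker dotpC. Qed.

Lemma lker_hyp_gt0 x : 0 < lker x x.
Proof.
rewrite subr_gt0 -(norm2_sqr (hyp_l2 x)) expr_lt1//; first exact: hyp_lt1.
exact: sqrtr_ge0.
Qed.

Lemma lker_bdry xi : lker xi xi = 0.
Proof. by rewrite /lker -(norm2_sqr (bdry_l2 xi)) bdry_eq1 expr1n subrr. Qed.

Lemma cball_hyp x : cball x.
Proof. by split; [exact: hyp_l2|exact/ltW/lker_hyp_gt0]. Qed.

Lemma cball_bdry xi : cball xi.
Proof. by split; [exact: bdry_l2|rewrite lker_bdry]. Qed.

Lemma lker_lin a u b v (w : nat -> R) : in_l2 d u -> in_l2 d v -> in_l2 d w -> a + b = 1 ->
  lker (fun i => a * u i + b * v i) w = a * lker u w + b * lker v w.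
Proof. by move=> lu lv lw ab; rewrite /lker (@dotp_linl R d)// -{1}ab; ring. Qed.

(** Reversed Cauchy-Schwarz inequality: the product is at most the square of the arithmetic mean of
    its factors, and [|u - v|^2 >= 0] bounds that mean by [lker u v]. *)
Lemma lker_cs u v : cball u -> cball v -> lker u u * lker v v <= lker u v ^+ 2.
Proof.
move=> [lu ru] [lv rv]; have cs := dotp_cs lu lv.
move: ru rv; rewrite /lker !subr_ge0 => ru rv.
have u0 := dotp_ge0 lu; have v0 := dotp_ge0 lv.
have l := in_l2_lin 1 (-1) lu lv; have := dotp_ge0 l.
rewrite (@dotp_linl R d)// !(@dotp_linr R d)// (dotpC v u) => h.
have p1 : dotp u v <= 1 by lra.
set p := dotp u v in p1 cs h *; set a := dotp u u in ru u0 cs h *.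
set b := dotp v v in rv v0 cs h *.
have k : (1 - a) * (1 - b) <= (1 - (a + b) / 2) ^+ 2.
  by have := sqr_ge0 (a - b); lra.
apply: le_trans k _; rewrite ler_sqr ?nnegrE; lra.
Qed.

Lemma lker_gt0 u x : cball u -> 0 < lker u x.
Proof.
move=> bu; have [lu ru] := bu; have lx := hyp_l2 x.
have cs := dotp_cs lu lx; move: ru (lker_hyp_gt0 x).
rewrite /lker subr_ge0 !subr_gt0 => ru rx.
have u0 := dotp_ge0 lu; have x0 := dotp_ge0 lx.
have h : dotp u x ^+ 2 < 1 by apply: le_lt_trans cs _; nra.
by rewrite ltNge; apply/negP => h1; nra.
Qed.

(* The combination A u1 + B u2 + C u3 is Lorentz-orthogonal to w, and the Lorentz
   form is definite on that hyperplane. *)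
Lemma lker_ptolemy u1 u2 u3 w : cball u1 -> cball u2 -> cball u3 ->
  lker u1 u3 * lker u2 w <=
    2 * (lker u1 u2 * lker u3 w + lker u2 u3 * lker u1 w).
Proof.
move=> b1 b2 b3; have [l1 r1] := b1; have [l2 r2] := b2; have [l3 r3] := b3.
have lw := hyp_l2 w.
have p1 := lker_gt0 w b1; have p2 := lker_gt0 w b2; have p3 := lker_gt0 w b3.
set a := lker u1 w in p1 *; set b := lker u2 w in p2 *; set c := lker u3 w in p3 *.
pose A := b * c; pose B := - (2 * a * c); pose C := a * b.
have l12 := in_l2_lin A B l1 l2.
have l := in_l2_lin 1 C l12 l3.
have cs := dotp_cs l lw.
have vw : dotp (fun i => 1 * (A * u1 i + B * u2 i) + C * u3 i) w = A + B + C.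
  rewrite !(@dotp_linl R d)//; have -> : dotp u1 w = 1 - a by rewrite /a /lker; ring.
  have -> : dotp u2 w = 1 - b by rewrite /b /lker; ring.
  have -> : dotp u3 w = 1 - c by rewrite /c /lker; ring.
  by rewrite /A /B /C; ring.
have vv := dotp_ge0 l.
have w1 := lker_hyp_gt0 w; rewrite /lker subr_gt0 in w1.
have w0 := dotp_ge0 lw.
have : (A + B + C) ^+ 2 <= dotp (fun i => 1 * (A * u1 i + B * u2 i) + C * u3 i)
                            (fun i => 1 * (A * u1 i + B * u2 i) + C * u3 i).
  by rewrite -vw; apply: le_trans cs _; rewrite ler_piMr// ltW.
rewrite !(@dotp_linl R d)// !(@dotp_linr R d)// (dotpC u2 u1) (dotpC u3 u1) (dotpC u3 u2).
have e u v : dotp u v = 1 - lker u v by rewrite /lker; ring.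
rewrite !e => h.
have k : A ^+ 2 * lker u1 u1 + B ^+ 2 * lker u2 u2 + C ^+ 2 * lker u3 u3 +
   2 * (A * B * lker u1 u2 + A * C * lker u1 u3 + B * C * lker u2 u3) <= 0 by lra.
have k1 : 0 <= A ^+ 2 * lker u1 u1 + B ^+ 2 * lker u2 u2 + C ^+ 2 * lker u3 u3.
  by rewrite !addr_ge0// mulr_ge0// sqr_ge0.
have k2 : A * B * lker u1 u2 + A * C * lker u1 u3 + B * C * lker u2 u3 <= 0 by lra.
have abc : 0 < a * b * c by rewrite !mulr_gt0.
have k3 : (a * b * c) * (lker u1 u3 * b - 2 * (lker u1 u2 * c + lker u2 u3 * a)) <= 0.
  by apply: le_trans k2; rewrite /A /B /C; lra.
by rewrite pmulr_rle0// subr_le0 in k3.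
Qed.

(** Lorentz length of the vector [(1, x)]; dividing by it moves the vector to the hyperboloid. *)
Definition hgt x : R := Num.sqrt (lker x x).

(* cosh of the hyperbolic distance.  It is locked because positivity lemmas such
   as mulr_gt0 would otherwise unfold it to a product. *)
Definition cd x y : R := locked (lker x y / (hgt x * hgt y)).

Lemma cdE x y : cd x y = lker x y / (hgt x * hgt y).
Proof. by rewrite /cd -lock. Qed.

(* exp of the Busemann function of xi based at the centre of the Klein ball. *)
Definition bt xi x : R := locked (lker xi x / hgt x).

Lemma btE xi x : bt xi x = lker xi x / hgt x.
Proof. by rewrite /bt -lock. Qed.

Lemma hgt_gt0 x : 0 < hgt x.
Proof. by rewrite sqrtr_gt0 lker_hyp_gt0. Qed.

Lemma hgt_sqr x : hgt x ^+ 2 = lker x x.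
Proof. by rewrite sqr_sqrtr// ltW// lker_hyp_gt0. Qed.

Lemma lker_cd x y : lker x y = cd x y * (hgt x * hgt y).
Proof. by rewrite cdE divfK// gt_eqF// mulr_gt0// hgt_gt0. Qed.

Lemma lker_bt xi x : lker xi x = bt xi x * hgt x.
Proof. by rewrite btE divfK// gt_eqF// hgt_gt0. Qed.

Lemma cdC x y : cd x y = cd y x.
Proof. by rewrite !cdE lkerC; congr (_ / _); exact: mulrC. Qed.

Lemma cdxx x : cd x x = 1.
Proof. by rewrite cdE -expr2 hgt_sqr divff// gt_eqF// lker_hyp_gt0. Qed.

Lemma cd_ge1 x y : 1 <= cd x y.
Proof.
have hx := hgt_gt0 x; have hy := hgt_gt0 y.
rewrite cdE ler_pdivlMr ?mulr_gt0// mul1r.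
have D0 := lker_gt0 y (cball_hyp x).
rewrite -ler_sqr ?nnegrE; [|by rewrite mulr_ge0// ltW|exact: ltW].
rewrite exprMn !hgt_sqr.
exact: lker_cs (cball_hyp x) (cball_hyp y).
Qed.

Lemma cd_gt0 x y : 0 < cd x y.
Proof. by apply: lt_le_trans (cd_ge1 x y). Qed.

Lemma bt_gt0 xi x : 0 < bt xi x.
Proof. by rewrite btE divr_gt0// ?hgt_gt0//; exact/lker_gt0/cball_bdry. Qed.

Lemma cd_ptolemy x y z w :
  cd x z * cd y w <= 2 * (cd x y * cd z w + cd y z * cd x w).
Proof.
have := lker_ptolemy w (cball_hyp x) (cball_hyp y) (cball_hyp z).
rewrite !lker_cd => h.
have p : 0 < hgt x * hgt y * hgt z * hgt w by rewrite !mulr_gt0 ?hgt_gt0.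
by rewrite -(ler_pM2r p); lra.
Qed.

Lemma bt_ptolemy xi x y z :
  cd x z * bt xi y <= 2 * (cd x y * bt xi z + cd y z * bt xi x).
Proof.
have := lker_ptolemy y (cball_hyp x) (cball_bdry xi) (cball_hyp z).
rewrite (lkerC x xi) !lker_cd !lker_bt (cdC y z) => h.
have p : 0 < hgt x * hgt y * hgt z by rewrite !mulr_gt0 ?hgt_gt0.
by rewrite -(ler_pM2r p); lra.
Qed.

Lemma bt_ptolemy2 xi xi' y w :
  lker xi xi' * cd y w <= 2 * (bt xi y * bt xi' w + bt xi' y * bt xi w).
Proof.
have := lker_ptolemy w (cball_bdry xi) (cball_hyp y) (cball_bdry xi').
rewrite (lkerC y xi') (lker_cd y) !lker_bt => h.
have p : 0 < hgt y * hgt w by rewrite !mulr_gt0 ?hgt_gt0.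
by rewrite -(ler_pM2r p); lra.
Qed.

(** A multiplicative triangle inequality: the four-point inequality at [w = y]. *)
Lemma cd_tri x y z : cd x z <= 4 * cd x y * cd y z.
Proof. have := cd_ptolemy x y z y; rewrite cdxx (cdC z y); lra. Qed.

Lemma arcoshE x y : hdist x y = arcosh (cd x y).
Proof. by rewrite cdE. Qed.

End Kernel.
Arguments cball {R} d u.

(** * The hyperbolic cosine and its inverse *)

Section Arcosh.
Context (R : realType).
Implicit Types c t r : R.

Lemma expR_arcosh c : 1 <= c -> expR (arcosh c) = c + Num.sqrt (c ^+ 2 - 1).
Proof.
move=> c1; rewrite lnK// posrE; apply: ltr_wpDr; first exact: sqrtr_ge0.
lra.
Qed.

Definition cosh t : R := (expR t + expR (- t)) / 2.

Lemma coshN t : cosh (- t) = cosh t.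
Proof. by rewrite /cosh opprK addrC. Qed.

Lemma arcosh_cosh t : 0 <= t -> arcosh (cosh t) = t.
Proof.
move=> t0; rewrite /arcosh.
have e1 : 1 <= expR t by rewrite -expR0 ler_expR.
have p := expR_gt0 t.
have -> : cosh t ^+ 2 - 1 = ((expR t - (expR t)^-1) / 2) ^+ 2.
  by rewrite /cosh expRN; field; rewrite gt_eqF.
rewrite sqrtr_sqr ger0_norm; last first.
  by have := invf_le1 p; rewrite e1; lra.
have -> : cosh t + (expR t - (expR t)^-1) / 2 = expR t.
  by rewrite /cosh expRN; field; rewrite gt_eqF.
exact: expRK.
Qed.

Lemma arcosh_cosh_norm t : arcosh (cosh t) = `|t|.
Proof.
have [t0|/ltW t0] := leP 0 t; first by rewrite ger0_norm// arcosh_cosh.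
by rewrite ler0_norm// -coshN arcosh_cosh// oppr_ge0.
Qed.

Lemma cosh_arcosh c : 1 <= c -> cosh (arcosh c) = c.
Proof.
move=> c1; rewrite /cosh expRN expR_arcosh//.
have h : 0 <= c ^+ 2 - 1 by nra.
have s0 := sqrtr_ge0 (c ^+ 2 - 1); have sE := sqr_sqrtr h.
set s := Num.sqrt _ in s0 sE *.
have cs : c + s != 0 by rewrite gt_eqF//; lra.
have -> : (c + s)^-1 = c - s.
  by apply: (mulfI cs); rewrite divff//; lra.
lra.
Qed.

Lemma arcosh_ge0 c : 1 <= c -> 0 <= arcosh c.
Proof.
move=> c1; rewrite ln_ge0//; have := sqrtr_ge0 (c ^+ 2 - 1); lra.
Qed.

End Arcosh.

Section Dist.
Context (R : realType) (d : dimension).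
Implicit Types (x y z w : hyp R d).

Lemma hdist_ge0 x y : 0 <= hdist x y.
Proof. by rewrite arcoshE; exact/arcosh_ge0/cd_ge1. Qed.

Lemma cosh_hdist x y : cosh (hdist x y) = cd x y.
Proof. by rewrite arcoshE; exact/cosh_arcosh/cd_ge1. Qed.

Lemma cd_lt_expR x y r : hdist x y < r -> cd x y < expR r.
Proof.
move=> h; apply: le_lt_trans (_ : expR (hdist x y) < _); last by rewrite ltr_expR.
by rewrite arcoshE expR_arcosh ?cd_ge1// lerDl sqrtr_ge0.
Qed.

Lemma hdist_le_cd x y M : cd x y <= M -> hdist x y <= ln (2 * M).
Proof.
move=> h; have c1 := cd_ge1 x y.
rewrite arcoshE /arcosh ler_ln ?posrE; [|apply: ltr_wpDr; [exact: sqrtr_ge0|lra]|lra].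
have : Num.sqrt (cd x y ^+ 2 - 1) <= cd x y.
  rewrite -[leRHS]ger0_norm; last lra.
  by rewrite -sqrtr_sqr ler_wsqrtr//; lra.
lra.
Qed.

End Dist.

(** * Chords and geodesics *)

Section Chord.
Context (R : realType) (d : dimension).
Implicit Types (u v : nat -> R) (x y z w : hyp R d) (xi : bdry R d) (s t : R).

Lemma hyp_inj x y : hyp_val x = hyp_val y -> x = y.
Proof.
case: x y => [u lu nu] [v lv nv]/= e; subst v.
by rewrite (Prop_irrelevance lu lv) (bool_irrelevance nu nv).
Qed.

Lemma bdry_inj xi xi' : bdry_val xi = bdry_val xi' -> xi = xi'.
Proof.
case: xi xi' => [u lu nu] [v lv nv]/= e; subst v.
by rewrite (Prop_irrelevance lu lv) (Prop_irrelevance nu nv).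
Qed.

Lemma ex_hyp u : in_l2 d u -> 0 < lker u u -> exists x : hyp R d, hyp_val x = u.
Proof.
move=> lu pu; have nu : norm2 u < 1.
  rewrite -[ltRHS]sqrtr1 ltr_sqrt//; rewrite /lker in pu; lra.
by exists (Hyp lu nu).
Qed.

Lemma ex_bdry u : in_l2 d u -> dotp u u = 1 -> exists x : bdry R d, bdry_val x = u.
Proof.
move=> lu pu; have nu : norm2 u = 1 by rewrite /norm2 pu sqrtr1.
by exists (Bdry lu nu).
Qed.

(** Equality case of the reversed Cauchy-Schwarz inequality: the vector
    [lker y y * (1, x) - lker x y * (1, y)] is null and Lorentz-orthogonal to the timelike [(1, y)],
    hence zero. *)
Lemma cd_eq1 x y : cd x y = 1 -> x = y.
Proof.
move=> h; have lx := hyp_l2 x; have ly := hyp_l2 y.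
have A0 := lker_hyp_gt0 x; have B0 := lker_hyp_gt0 y.
have e : lker x y ^+ 2 = lker x x * lker y y.
  by rewrite (lker_cd x y) h mul1r exprMn !hgt_sqr.
have ly1 : dotp y y < 1 by rewrite /lker in B0; lra.
have l := in_l2_lin (lker y y) (- lker x y) lx ly.
have cs := dotp_cs l ly; have vv := dotp_ge0 l.
have h1 : dotp (fun i => lker y y * x i + - lker x y * y i) y = lker y y - lker x y.
  by rewrite (@dotp_linl R d)// /lker; ring.
have h2 : dotp (fun i => lker y y * x i + - lker x y * y i)
            (fun i => lker y y * x i + - lker x y * y i) = (lker y y - lker x y) ^+ 2.
  rewrite (@dotp_linl R d)// !(@dotp_linr R d)// (dotpC y x).
  have -> : dotp x x = 1 - lker x x by rewrite /lker; ring.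
  have -> : dotp y y = 1 - lker y y by rewrite /lker; ring.
  have -> : dotp x y = 1 - lker x y by rewrite /lker; ring.
  set a := lker x x in e *; set b := lker y y in e *; set c := lker x y in e *.
  have : b * c ^+ 2 = b * (a * b) by rewrite e.
  lra.
rewrite h1 h2 in cs; rewrite h2 in vv.
have q0 : (lker y y - lker x y) ^+ 2 = 0 by nra.
have q1 : lker x y = lker y y by move/eqP: q0; rewrite sqrf_eq0 subr_eq0 => /eqP.
apply/hyp_inj/funext => i.
have := sqr_le_dotp i l; rewrite h2 q0 q1 => hi.
have {hi} : (lker y y * x i + - lker y y * y i) ^+ 2 = 0.
  by apply/eqP; rewrite eq_le hi sqr_ge0.
move/eqP; rewrite sqrf_eq0 mulNr subr_eq0 => /eqP; apply: mulfI.
by rewrite gt_eqF.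
Qed.

Lemma chord_subproof x y s : 0 <= s <= 1 ->
  exists z : hyp R d, hyp_val z = (fun i => (1 - s) * x i + s * y i).
Proof.
move=> /andP[s0 s1]; have lx := hyp_l2 x; have ly := hyp_l2 y.
have l := in_l2_lin (1 - s) s lx ly; apply: ex_hyp => //.
have ab : 1 - s + s = 1 by ring.
have ex := lker_lin lx ly lx ab; have ey := lker_lin lx ly ly ab.
rewrite lkerC in ex; rewrite lkerC in ey.
rewrite (lker_lin lx ly l ab) ex ey.
have A0 := lker_hyp_gt0 x; have B0 := lker_hyp_gt0 y.
have D0 := lker_gt0 y (cball_hyp x); rewrite (lkerC y x).
have s1' : 0 <= 1 - s by lra.
have h1 : 0 <= (1 - s) * s * lker x y by rewrite !mulr_ge0// ltW.
have h2 : 0 <= s ^+ 2 * lker y y by rewrite mulr_ge0 ?sqr_ge0// ltW.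
have h3 : 0 <= (1 - s) ^+ 2 * lker x x by rewrite mulr_ge0 ?sqr_ge0// ltW.
have [s2|s2] := leP s (1 / 2).
  have : 0 < (1 - s) ^+ 2 * lker x x by rewrite mulr_gt0// exprn_gt0//; lra.
  lra.
have : 0 < s ^+ 2 * lker y y by rewrite mulr_gt0// exprn_gt0//; lra.
lra.
Qed.

(** The default value [x] outside [[0, 1]] lets [chordxx] hold for every [s]. *)
Definition chord x y s : hyp R d :=
  if pselect (0 <= s <= 1) is left h then projT1 (cid (chord_subproof x y h)) else x.

Lemma chordE x y s : 0 <= s <= 1 ->
  hyp_val (chord x y s) = (fun i => (1 - s) * x i + s * y i).
Proof. by move=> h; rewrite /chord; case: pselect => // h'; case: cid. Qed.

Lemma lker_chord x y s u : 0 <= s <= 1 -> in_l2 d u ->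
  lker (chord x y s) u = (1 - s) * lker x u + s * lker y u.
Proof.
move=> h lu; have ab : 1 - s + s = 1 by ring.
by rewrite chordE// (lker_lin (hyp_l2 x) (hyp_l2 y) lu ab).
Qed.

Lemma lker_chord2 x y s t : 0 <= s <= 1 -> 0 <= t <= 1 ->
  lker (chord x y s) (chord x y t) = (1 - s) * (1 - t) * lker x x +
    ((1 - s) * t + s * (1 - t)) * lker x y + s * t * lker y y.
Proof.
move=> hs ht; rewrite lker_chord//; last exact: hyp_l2.
rewrite (lkerC x (chord _ _ _)) (lkerC y (chord _ _ _)).
rewrite !lker_chord//; try exact: hyp_l2.
by rewrite (lkerC y x); ring.
Qed.

Lemma chord0 x y : chord x y 0 = x.
Proof.
apply: hyp_inj; rewrite chordE ?lexx ?ler01//.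
by apply/funext => i; ring.
Qed.

Lemma chord1 x y : chord x y 1 = y.
Proof.
apply: hyp_inj; rewrite chordE ?lexx ?ler01//.
by apply/funext => i; ring.
Qed.

Lemma chordxx x s : chord x x s = x.
Proof.
apply: hyp_inj; have [h|/negP h] := boolP (0 <= s <= 1).
  by rewrite chordE//; apply/funext => i; ring.
by rewrite /chord; case: pselect.
Qed.

(** This is [cosh a * cosh b <= cosh (a + b)] for a point between [x] and [y]. After clearing
    heights, the difference of the two sides is exactly [s * (1 - s)] times the defect in
    [lker_cs]. *)
Lemma cd_chord x y s : 0 <= s <= 1 ->
  cd x (chord x y s) * cd (chord x y s) y <= cd x y.
Proof.
move=> hs; set c := chord x y s.
have A0 := lker_hyp_gt0 x; have B0 := lker_hyp_gt0 y; have C0 := lker_hyp_gt0 c.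
have cs := lker_cs (cball_hyp x) (cball_hyp y).
have D0 := lker_gt0 y (cball_hyp x).
rewrite -(@ler_pM2r _ (hgt x * hgt y * lker c c)); last first.
  by rewrite !mulr_gt0// hgt_gt0.
have -> : cd x y * (hgt x * hgt y * lker c c) =
  lker x y * lker c c by rewrite (lker_cd x y); ring.
have -> : cd x c * cd c y * (hgt x * hgt y * lker c c) =
  lker x c * lker c y.
  by rewrite (lker_cd x c) (lker_cd c y) -(hgt_sqr c); ring.
rewrite (lkerC x c) {2}/c lker_chord2// /c !lker_chord//; try exact: hyp_l2.
rewrite (lkerC y x).
have : 0 <= s * (1 - s) * (lker x y ^+ 2 - lker x x * lker y y).
  by rewrite !mulr_ge0//; lra.
lra.
Qed.

Definition dsinh t : R := expR t - expR (- t).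

(** With [a = expR t] and [E = expR D] the equation becomes [a^2 * (p + q / E) = p + q * E]; the
    bounds [1 <= a^2 <= E^2] place [t] in [[0, D]]. *)
Lemma ex_geodesic_param (D p q : R) : 0 <= D -> 0 <= p -> 0 <= q -> 0 < p + q ->
  exists2 t, 0 <= t <= D & p * dsinh t = q * dsinh (D - t).
Proof.
move=> D0 p0 q0 pq; have E1 : 1 <= expR D by rewrite -expR0 ler_expR.
have E0 := expR_gt0 D.
set E := expR D in E1 E0 *.
have den : 0 < p + q / E.
  move: p0; rewrite le_eqVlt => /orP[/eqP p0|p0].
    by rewrite -p0 add0r divr_gt0//; lra.
  by rewrite ltr_pwDl// divr_ge0// ltW.
have num : 0 < p + q * E by nra.
pose r := (p + q * E) / (p + q / E).
have r0 : 0 < r by rewrite divr_gt0.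
have Ei : E^-1 <= 1 by rewrite invf_le1.
have Ei0 : 0 < E^-1 by rewrite invr_gt0.
have r1 : 1 <= r by rewrite ler_pdivlMr// mul1r lerD2l ler_wpM2l//; lra.
have rE : r <= E ^+ 2.
  rewrite ler_pdivrMr//; have -> : E ^+ 2 * (p + q / E) = p * E ^+ 2 + q * E.
    by field; rewrite gt_eqF.
  by rewrite lerD2r ler_peMr// exprn_ege1.
have a0 : 0 < Num.sqrt r by rewrite sqrtr_gt0.
have ta : expR (ln (Num.sqrt r)) = Num.sqrt r by rewrite lnK.
have aa : Num.sqrt r ^+ 2 = r by rewrite sqr_sqrtr// ltW.
exists (ln (Num.sqrt r)).
  rewrite ln_ge0/=; last by rewrite -[leLHS]sqrtr1 ler_wsqrtr.
  by rewrite -ler_expR ta -/E -ler_sqr ?nnegrE ?aa// ltW.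
rewrite /dsinh opprB !expRB expRN ta -/E.
set a := Num.sqrt r in a0 ta aa *.
have h : a ^+ 2 * (p + q / E) = p + q * E.
  by rewrite aa /r divfK// gt_eqF.
apply: (mulIf (x := a)); first by rewrite gt_eqF.
have -> : p * (a - a^-1) * a = p * a ^+ 2 - p by field; rewrite gt_eqF.
have -> : q * (E / a - a / E) * a = q * E - a ^+ 2 * (q / E).
  by field; rewrite !gt_eqF.
lra.
Qed.

(** [hconvex] speaks of arc-length geodesics, so the chord is first reparametrised by arc length. *)
Lemma hconvex_chord (A : set (hyp R d)) x y s : hconvex A -> A x -> A y ->
  0 <= s <= 1 -> A (chord x y s).
Proof.
move=> cA Ax Ay hs; have /andP[s0 s1] := hs.
have [->|xy] := pselect (x = y); first by rewrite chordxx.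
have cxy : 1 < cd x y.
  rewrite lt_def cd_ge1 andbT; apply/eqP => /cd_eq1; exact: xy.
pose D := hdist x y.
have D0 : 0 < D.
  rewrite lt_def hdist_ge0 andbT; apply/eqP => D0.
  have := cosh_hdist x y; rewrite -/D D0 /cosh oppr0 expR0; lra.
pose a := hgt x; pose b := hgt y.
have A0 := lker_hyp_gt0 x; have B0 := lker_hyp_gt0 y.
have a0 : 0 < a by exact: hgt_gt0.
have b0 : 0 < b by exact: hgt_gt0.
have aE : lker x x = a ^+ 2 by rewrite hgt_sqr.
have bE : lker y y = b ^+ 2 by rewrite hgt_sqr.
have DE : lker x y = cosh D * (a * b) by rewrite cosh_hdist -lker_cd.
have S0 t : 0 <= t -> 0 <= dsinh t by move=> t0; rewrite subr_ge0 ler_expR; lra.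
have Sp t : 0 < t -> 0 < dsinh t by move=> t0; rewrite subr_gt0 ltr_expR; lra.
(* On the hyperboloid the geodesic is [sinh (D - t) X / a + sinh t Y / b] up to the factor [sinh D],
   with [X = (1, x)] and [Y = (1, y)]. Multiplying by [a * b] gives these weights, which [sg]
   rescales to sum 1. *)
pose lam t := dsinh (D - t) * b; pose mu t := dsinh t * a.
have lam0 t : t <= D -> 0 <= lam t by move=> h; rewrite mulr_ge0 ?S0 ?subr_ge0// ltW.
have mu0 t : 0 <= t -> 0 <= mu t by move=> h; rewrite mulr_ge0 ?S0// ltW.
have Lp t : 0 <= t <= D -> 0 < lam t + mu t.
  move=> /andP[t0 tD]; have [h|h] := ltP t D.
    by apply: ltr_pwDl (mu0 _ t0); rewrite mulr_gt0 ?Sp ?subr_gt0.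
  by apply: ltr_wpDl (lam0 _ tD) _; rewrite mulr_gt0 ?Sp//; lra.
pose sg t := mu t / (lam t + mu t).
have sgh t : 0 <= t <= D -> 0 <= sg t <= 1.
  move=> h; have := Lp t h; have /andP[t0 tD] := h => L.
  rewrite /sg; apply/andP; split; first by rewrite divr_ge0 ?mu0// ltW.
  by rewrite ler_pdivrMr// mul1r lerDr lam0.
have kerE t t' : 0 <= t <= D -> 0 <= t' <= D ->
    lker (chord x y (sg t)) (chord x y (sg t')) =
    (a * b * dsinh D) ^+ 2 * cosh (t - t') / ((lam t + mu t) * (lam t' + mu t')).
  move=> h h'; rewrite lker_chord2 ?sgh// aE bE DE.
  have L := Lp t h; have L' := Lp t' h'.
  have e1 : 1 - sg t = lam t / (lam t + mu t) by rewrite /sg; field; rewrite gt_eqF.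
  have e2 : 1 - sg t' = lam t' / (lam t' + mu t') by rewrite /sg; field; rewrite gt_eqF.
  rewrite e1 e2 /sg.
  set L1 := _ + _ in L *; set L2 := _ + _ in L' *.
  have : lam t * lam t' * a ^+ 2 + (lam t * mu t' + mu t * lam t') * (cosh D * (a * b))
     + mu t * mu t' * b ^+ 2 = (a * b * dsinh D) ^+ 2 * cosh (t - t').
    rewrite /lam /mu /cosh /dsinh !opprB !expRB !expRN.
    by field; rewrite !gt_eqF ?expR_gt0.
  move=> <-; field; by rewrite !gt_eqF.
have SD := Sp D D0.
have cdE t t' : 0 <= t <= D -> 0 <= t' <= D ->
    cd (chord x y (sg t)) (chord x y (sg t')) = cosh (t - t').
  move=> h h'; have L := Lp t h; have L' := Lp t' h'.
  have rE r : 0 <= r <= D -> hgt (chord x y (sg r)) =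
      a * b * dsinh D / (lam r + mu r).
    move=> hr; have Lr := Lp r hr; rewrite /hgt kerE// subrr {1}/cosh oppr0 expR0.
    have -> : (a * b * dsinh D) ^+ 2 * ((1 + 1) / 2) / ((lam r + mu r) * (lam r + mu r)) =
      (a * b * dsinh D / (lam r + mu r)) ^+ 2 by field; rewrite gt_eqF.
    by rewrite sqrtr_sqr ger0_norm// divr_ge0 ?mulr_ge0 ?ltW.
  rewrite cdE kerE// !rE//; field; rewrite !gt_eqF//.
have sg0 : sg 0 = 0 by rewrite /sg /mu /dsinh oppr0 subrr !mul0r.
have sgD : sg D = 1.
  have := Lp D; rewrite (ltW D0) lexx /sg /lam subrr /dsinh oppr0 subrr mul0r add0r => h.
  by rewrite divff// gt_eqF// h.
have gp : geodesic_path x y (fun t => chord x y (sg t)).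
  split; [by rewrite sg0 chord0|by rewrite -/D sgD chord1|].
  by move=> t t' h h'; rewrite arcoshE cdE// arcosh_cosh_norm.
(* The equation is [s = sg t] with denominators cleared. *)
have [t ht te] : exists2 t, 0 <= t <= D & (1 - s) * a * dsinh t = s * b * dsinh (D - t).
  apply: ex_geodesic_param.
  - exact: ltW.
  - by rewrite mulr_ge0 ?subr_ge0 ?(ltW a0).
  - by rewrite mulr_ge0 ?(ltW b0).
  - have [h|h] := ltP s (1 / 2).
      apply: ltr_pwDl; first by rewrite mulr_gt0//; lra.
      by rewrite mulr_ge0 ?(ltW b0).
    apply: ltr_wpDl; first by rewrite mulr_ge0 ?subr_ge0 ?(ltW a0).
    by rewrite mulr_gt0//; lra.
have -> : s = sg t.
  have L := Lp t ht; apply: (mulIf (x := lam t + mu t)); first by rewrite gt_eqF.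
  by rewrite /sg divfK ?gt_eqF// /lam /mu; lra.
exact: cA Ax Ay gp t ht.
Qed.

End Chord.

(** * The boundary and Busemann functions *)

Section Boundary.
Context (R : realType) (d : dimension).
Implicit Types (u v : nat -> R) (x y z w o : hyp R d) (xi : bdry R d) (e : R).

Lemma norm2_cball u : cball d u -> norm2 u <= 1.
Proof.
move=> [lu]; rewrite /lker subr_ge0 => h.
by rewrite -[leRHS]sqrtr1 ler_wsqrtr.
Qed.

(** Together with [dist2_le_lker], this translates between Euclidean closeness at the boundary and
    smallness of [lker], which isometries control. *)
Lemma lker_le_dist2 u v xi : cball d u -> cball d v ->
  lker u v <= dist2 u xi + dist2 v xi.
Proof.
move=> bu bv; have [lu _] := bu; have [lv _] := bv; have lx := bdry_l2 xi.
have h1 := dotpB_le lx lv lx; have h2 := dotpB_le lx lu lv.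
rewrite bdry_eq1 mul1r (dist2C xi) in h1.
have {}h2 : `|dotp v xi - dotp v u| <= dist2 u xi.
  apply: le_trans h2 _; rewrite (dist2C xi) ler_piMl ?dist2_ge0//.
  exact: norm2_cball.
have e1 : dotp xi xi = 1 by rewrite -(norm2_sqr lx) bdry_eq1 expr1n.
move: h1 h2; rewrite e1 (dotpC xi v) /lker (dotpC u v) !ler_norml.
move=> /andP[_ h1] /andP[_ h2]; lra.
Qed.

Lemma dist2_le_lker u v : cball d u -> cball d v -> dist2 u v ^+ 2 <= 2 * lker u v.
Proof.
move=> [lu ru] [lv rv]; rewrite (dist2_sqr lu lv).
by move: ru rv; rewrite /lker; lra.
Qed.

Lemma ex_hyp_near xi e : 0 < e -> exists x : hyp R d, dist2 x xi < e.
Proof.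
move=> e0; have lx := bdry_l2 xi.
have e1 : dotp xi xi = 1 by rewrite -(norm2_sqr lx) bdry_eq1 expr1n.
pose a := Num.min e 1 / 2.
have m0 : 0 < Num.min e 1 by rewrite lt_min e0/=.
have me : Num.min e 1 <= e by rewrite ge_min lexx.
have m1 : Num.min e 1 <= 1 by rewrite ge_min lexx orbT.
have l := in_l2_lin (1 - a) 0 lx lx.
have du : dotp (fun i => (1 - a) * xi i + 0 * xi i) (fun i => (1 - a) * xi i + 0 * xi i)
    = (1 - a) ^+ 2.
  by rewrite (@dotp_linl R d)// !(@dotp_linr R d)// e1; ring.
have [|x xE] := ex_hyp l.
  by rewrite /lker du /a; nra.
exists x; rewrite -(@ltr_pXn2r _ 2) ?nnegrE ?dist2_ge0 ?(ltW e0)//.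
rewrite (dist2_sqr (hyp_l2 x) lx) xE du (@dotp_linl R d)// e1 /a; nra.
Qed.

Global Instance at_bdry_filter xi : ProperFilter (at_bdry xi).
Proof.
apply: filter_from_proper; last first.
  by move=> e e0; have [x hx] := ex_hyp_near xi e0; exists x.
apply: filter_from_filter; first by exists 1 => /=.
move=> e f /= e0 f0; exists (Num.min e f); first by rewrite /= lt_min e0.
by move=> x /=; rewrite lt_min => /andP[].
Qed.

Lemma cvg_at_bdry (f : nat -> hyp R d) xi : f @ \oo --> at_bdry xi <->
  forall e, 0 < e -> exists N, forall n, (N <= n)%N -> dist2 (f n) xi < e.
Proof.
split=> [h e e0|h U [e /= e0 eU]].
  have [|N _ hN] := h [set x : hyp R d | dist2 x xi < e]; first by exists e.
  by exists N.
by have [N hN] := h e e0; exists N => // n Nn; apply: eU; exact: hN.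
Qed.

Lemma lker_cvg x xi : (fun y : hyp R d => lker x y) @ at_bdry xi --> lker x xi.
Proof.
apply/cvgrPdist_le => e e0; exists e => //= y /= hy.
have := dotpB_le (bdry_l2 xi) (hyp_l2 y) (hyp_l2 x).
have n1 := norm2_cball (cball_hyp x).
have n0 : 0 <= norm2 x by exact: sqrtr_ge0.
have d0 := dist2_ge0 xi y.
have -> : lker x xi - lker x y = - (dotp x xi - dotp x y) by rewrite /lker; ring.
rewrite normrN (dist2C y) in hy * => /le_trans; apply.
by nra.
Qed.

Lemma lker_cvg0 xi : (fun y : hyp R d => lker y y) @ at_bdry xi --> (0 : R).
Proof.
apply/cvgrPdist_le => e e0; exists (e / 2); first by rewrite /=; lra.
move=> y /= hy; have := lker_le_dist2 xi (cball_hyp y) (cball_hyp y).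
rewrite sub0r normrN ger0_norm; first lra.
exact/ltW/lker_hyp_gt0.
Qed.

(** [hdist x y] equals [ln (N x y) - ln (hgt y)]. The divergent term does not involve [x] and
    cancels; [N x y] tends to [2 * bt xi x] because [lker y y] tends to 0. *)
Lemma busemannE xi o x : busemann xi o x = ln (2 * bt xi x) - ln (2 * bt xi o).
Proof.
pose N x y := (lker x y + Num.sqrt (lker x y ^+ 2 - lker x x * lker y y)) / hgt x.
have Np z y : 0 < N z y.
  by rewrite divr_gt0 ?hgt_gt0// ltr_pwDl ?sqrtr_ge0// lker_gt0//; exact: cball_hyp.
have hE z y : hdist z y = ln (N z y) - ln (hgt y).
  have hz := hgt_gt0 z; have hy := hgt_gt0 y.
  have -> : hdist z y = ln (N z y / hgt y); last by rewrite ln_div// posrE.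
  rewrite arcoshE /arcosh /N; congr ln.
  have -> : cd z y ^+ 2 - 1 = (lker z y ^+ 2 - lker z z * lker y y) / (hgt z * hgt y) ^+ 2.
    rewrite -!(hgt_sqr z) -!(hgt_sqr y) cdE; field; by rewrite !gt_eqF.
  have p : 0 <= (hgt z * hgt y) ^- 2 by rewrite invr_ge0 sqr_ge0.
  rewrite sqrtrM; last first.
    by rewrite subr_ge0; apply: lker_cs; exact: cball_hyp.
  rewrite sqrtrV ?sqr_ge0// sqrtr_sqr ger0_norm; last by rewrite mulr_ge0// ltW.
  by rewrite cdE; field; rewrite !gt_eqF.
have cN z : (fun y => ln (N z y)) @ at_bdry xi --> ln (2 * bt xi z).
  have c1 := lker_cvg (x := z) (xi := xi).
  have z0 := lker_gt0 z (cball_bdry xi).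
  have hz := hgt_gt0 z.
  have c2 : (fun y => N z y) @ at_bdry xi --> 2 * bt xi z.
    have -> : 2 * bt xi z =
       (lker z xi + Num.sqrt (lker z xi * lker z xi - lker z z * 0)) * (hgt z)^-1.
      rewrite mulr0 subr0 -expr2 sqrtr_sqr ger0_norm ?(lkerC z)//; last exact: ltW.
      by rewrite btE; field; rewrite gt_eqF.
    apply: cvgM; last exact: cvg_cst.
    apply: cvgD => //.
    apply: (@continuous_cvg _ _ _ _ _ _ (@Num.sqrt R)); first exact: sqrt_continuous.
    apply: cvgB; first by under eq_fun do rewrite expr2; exact: cvgM.
    by apply: cvgM; [exact: cvg_cst|exact: lker_cvg0].
  apply: (@continuous_cvg _ _ _ _ _ _ (@ln R)) c2.
  by apply: continuous_ln; rewrite mulr_gt0// bt_gt0.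
rewrite /busemann; apply: cvg_lim => //.
have -> : (fun y => hdist x y - hdist o y) = (fun y => ln (N x y) - ln (N o y)).
  by apply/funext => y; rewrite !hE; ring.
by apply: cvgB; exact: cN.
Qed.

Lemma horoball_bt o (B : set (hyp R d)) : horoball o B ->
  exists (xi : bdry R d) T, 0 < T /\ B = [set x | bt xi x < T].
Proof.
move=> [xi [t ->]]; exists xi, (bt xi o * expR t).
have b0 := bt_gt0 xi o; split; first by rewrite mulr_gt0// expR_gt0.
have b0' : 0 < 2 * bt xi o by lra.
apply/seteqP; split=> x /=; rewrite busemannE; have bx := bt_gt0 xi x.
  have bx' : 0 < 2 * bt xi x by lra.
  move=> h; have : expR (ln (2 * bt xi x)) < expR (ln (2 * bt xi o) + t).
    by rewrite ltr_expR; lra.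
  by rewrite expRD !lnK ?posrE//; lra.
have bx' : 0 < 2 * bt xi x by lra.
by move=> h; rewrite ltrBlDr -ltr_expR expRD !lnK ?posrE//; lra.
Qed.

End Boundary.

(** * Isometries acting on the boundary and on the convex hull *)

Section Isometries.
Context (R : realType) (d : dimension).
Implicit Types (u v : nat -> R) (x y z w o p : hyp R d) (xi eta : bdry R d) (e : R).
Implicit Types (g h : hyp R d -> hyp R d).

Lemma dotp_norm2 u v : in_l2 d u -> in_l2 d v -> `|dotp u v| <= norm2 u * norm2 v.
Proof.
move=> lu lv; rewrite -ler_sqr ?nnegrE ?mulr_ge0 ?sqrtr_ge0//.
by rewrite real_normK ?num_real// exprMn (norm2_sqr lu) (norm2_sqr lv);
  exact: (dotp_cs lu lv).
Qed.

Lemma lker_le2 u v : cball d u -> cball d v -> lker u v <= 2.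
Proof.
move=> bu bv; have [lu _] := bu; have [lv _] := bv.
have := dotp_norm2 lu lv; rewrite ler_norml => /andP[h _].
have nu := norm2_cball bu; have nv := norm2_cball bv.
have u0 : 0 <= norm2 u := sqrtr_ge0 _; have v0 : 0 <= norm2 v := sqrtr_ge0 _.
rewrite /lker; nra.
Qed.

Lemma lker_ge_norm2 u o : cball d u -> 1 - norm2 o <= lker u o.
Proof.
move=> bu; have [lu _] := bu.
have := dotp_norm2 lu (hyp_l2 o); rewrite ler_norml => /andP[_ h].
have nu := norm2_cball bu.
have u0 : 0 <= norm2 u := sqrtr_ge0 _; have v0 : 0 <= norm2 o := sqrtr_ge0 _.
rewrite /lker; nra.
Qed.

Lemma hgt_le1 x : hgt x <= 1.
Proof.
have h := hgt_gt0 x.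
rewrite -(@ler_pXn2r _ 2) ?nnegrE ?(ltW h)// hgt_sqr expr1n /lker.
by have := dotp_ge0 (hyp_l2 x); lra.
Qed.

Lemma cd_hgt_ge x o : 1 - norm2 o <= cd x o * hgt x.
Proof.
apply: le_trans (lker_ge_norm2 o (cball_hyp x)) _.
rewrite lker_cd; have := hgt_le1 o; have := hgt_gt0 x; have := cd_gt0 x o.
move=> c0 x0 o1; rewrite mulrA ler_piMr// ltW// mulr_gt0//.
Qed.

(** [hgt x] is comparable to the inverse of [cd x o], and [g] changes the latter at most by the
    factor [4 * cd o (g o)]. *)
Lemma hgt_isom o g : (forall x y, cd (g x) (g y) = cd x y) ->
  exists2 K, 0 < K & forall x, hgt (g x) <= K * hgt x.
Proof.
move=> ig; have m0 : 0 < 1 - norm2 o by rewrite subr_gt0 hyp_lt1.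
have o0 := hgt_gt0 o.
exists (8 * cd o (g o) / ((1 - norm2 o) * hgt o)).
  apply: divr_gt0; last exact: mulr_gt0.
  by apply: mulr_gt0; [lra|exact: cd_gt0].
move=> x; rewrite mulrAC ler_pdivlMr ?mulr_gt0//.
have h1 := lker_le2 (cball_hyp (g x)) (cball_hyp o).
rewrite lker_cd in h1.
have h2 := cd_tri (g x) o (g o); rewrite ig in h2.
have h3 := cd_hgt_ge x o.
have g0 := hgt_gt0 (g x); have x0 := hgt_gt0 x.
have c0 := cd_gt0 (g x) o; have k0 := cd_gt0 o (g o).
apply: (@le_trans _ _ (hgt (g x) * (cd x o * hgt x * hgt o))).
  by rewrite !ler_pM2l// ler_pM2r.
apply: (@le_trans _ _ (hgt (g x) * (4 * cd (g x) o * cd o (g o) * hgt x * hgt o))).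
  by rewrite ler_pM2l// !ler_pM2r.
have -> : hgt (g x) * (4 * cd (g x) o * cd o (g o) * hgt x * hgt o) =
  (cd (g x) o * (hgt (g x) * hgt o)) * (4 * cd o (g o) * hgt x) by ring.
have -> : 8 * cd o (g o) * hgt x = 2 * (4 * cd o (g o) * hgt x) by ring.
by rewrite ler_pM2r// !mulr_gt0.
Qed.

Lemma lker_isom o g : (forall x y, cd (g x) (g y) = cd x y) ->
  exists2 K, 0 < K & forall x y, lker (g x) (g y) <= K * lker x y.
Proof.
move=> ig; have [K K0 hK] := hgt_isom o ig.
exists (K ^+ 2) => [|x y]; first by rewrite exprn_gt0.
rewrite !lker_cd ig [leRHS]mulrCA ler_pM2l ?cd_gt0//.
have -> : K ^+ 2 * (hgt x * hgt y) = (K * hgt x) * (K * hgt y) by ring.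
by rewrite ler_pM ?hK// ltW// hgt_gt0.
Qed.

(** Near [xi] the values of [lker] are small, [g] enlarges them at most [K] times, and they bound
    squared distances. So the images of a sequence tending to [xi] are Cauchy, and completeness
    supplies the limit in any dimension. *)
Lemma isom_bdry o g xi : (forall x y, cd (g x) (g y) = cd x y) ->
  exists xi' : bdry R d, forall e, 0 < e ->
    exists2 eta, 0 < eta & forall x, dist2 x xi < eta -> dist2 (g x) xi' < e.
Proof.
move=> ig; have [K K0 hK] := lker_isom o ig.
have gd x y : dist2 (g x) (g y) ^+ 2 <= 2 * K * (dist2 x xi + dist2 y xi).
  apply: le_trans (dist2_le_lker (cball_hyp _) (cball_hyp _)) _.
  rewrite -mulrA ler_pM2l//; apply: le_trans (hK x y) _.
  by rewrite ler_pM2l//; apply: lker_le_dist2; exact: cball_hyp.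
have gd2 e x y : 0 < e -> dist2 x xi < e ^+ 2 / (4 * K) -> dist2 y xi < e ^+ 2 / (4 * K) ->
    dist2 (g x) (g y) < e.
  move=> e0 hx hy; rewrite -(@ltr_pXn2r _ 2) ?nnegrE ?dist2_ge0 ?(ltW e0)//.
  apply: le_lt_trans (gd x y) _.
  have -> : e ^+ 2 = 2 * K * (e ^+ 2 / (4 * K) + e ^+ 2 / (4 * K)).
    by field; rewrite gt_eqF.
  by rewrite ltr_pM2l ?mulr_gt0//; lra.
pose f n := projT1 (cid (@ex_hyp_near _ _ xi n.+1%:R^-1 ltac:(by rewrite invr_gt0))).
have fE n : dist2 (f n) xi < n.+1%:R^-1 by rewrite /f; case: cid.
have fN e : 0 < e -> exists N, forall n, (N <= n)%N -> dist2 (f n) xi < e.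
  move=> e0; have [N hN] : exists N : nat, N.+1%:R^-1 < e.
    exists (Num.Def.truncn e^-1); rewrite invf_plt ?posrE//.
    exact: truncnS_gt.
  exists N => n Nn; apply: lt_trans (fE n) _; apply: le_lt_trans hN.
  by rewrite lef_pV2 ?posrE// ler_nat.
have [u [lu hu]] : exists u, in_l2 d u /\ forall e, 0 < e ->
    exists N, forall n, (N <= n)%N -> dist2 (g (f n)) u <= e.
  apply: (@l2_complete _ _ (fun n => hyp_val (g (f n)))) => [n|e e0].
    exact: hyp_l2.
  have [|N hN] := fN (e ^+ 2 / (4 * K)).
    by rewrite divr_gt0 ?mulr_gt0 ?exprn_gt0//; lra.
  by exists N => n m Nn Nm; apply/ltW/gd2 => //; exact: hN.
(* [lker y y] tends to 0 along the images [y], so their limit lies on the unit sphere. *)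
have nu : dotp u u = 1.
  suff : forall e, 0 < e -> `|dotp u u - 1| <= e.
    move=> h; apply/eqP; rewrite -subr_eq0 -normr_le0; apply/ler_addgt0Pl => e e0.
    by rewrite addr0; exact: h.
  move=> e e0.
  pose e1 := Num.min (e / 4) 1.
  have e10 : 0 < e1 by rewrite lt_min; apply/andP; split; lra.
  have e11 : e1 <= 1 by rewrite ge_min lexx orbT.
  have e1e : e1 <= e / 4 by rewrite ge_min lexx.
  have [N1 h1] := hu e1 e10.
  have [|N2 h2] := fN (e1 / (2 * K)); first by rewrite divr_gt0// mulr_gt0.
  pose n := maxn N1 N2; pose y := g (f n).
  have {}h1 : dist2 y u <= e1 by apply: h1; exact: leq_maxl.
  have {}h2 := h2 n (leq_maxr _ _).
  have y0 : 0 < lker y y := lker_hyp_gt0 y.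
  have y1 : lker y y <= e1.
    apply: le_trans (hK _ _) _.
    have := lker_le_dist2 xi (cball_hyp (f n)) (cball_hyp (f n)) => h3.
    have -> : e1 = K * (e1 / (2 * K) + e1 / (2 * K)) by field; rewrite gt_eqF.
    by rewrite ler_pM2l//; lra.
  have ly := hyp_l2 y.
  have := dist2_sqr ly lu => h3.
  have h4 := dotpB_le lu ly ly.
  have ny := norm2_cball (cball_hyp y).
  have ny0 : 0 <= norm2 y := sqrtr_ge0 _.
  have d0 := dist2_ge0 u y.
  have {}h4 : `|dotp y u - dotp y y| <= e1.
    by apply: le_trans h4 _; rewrite dist2C in h1; nra.
  have h5 : dist2 y u ^+ 2 <= e1.
    by have := dist2_ge0 y u; nra.
  have h6 : 0 <= dist2 y u ^+ 2 by exact: sqr_ge0.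
  move: h4 y1 y0; rewrite !ler_norml /lker => /andP[h7 h8] y1 y0.
  by apply/andP; split; lra.
have [xi' xiE] := ex_bdry lu nu.
exists xi' => e e0; exists ((e / 2) ^+ 2 / (4 * K)).
  by rewrite divr_gt0 ?mulr_gt0 ?exprn_gt0//; lra.
move=> x hx; rewrite xiE.
have [N1 h1] := hu (e / 4) ltac:(lra).
have [|N2 h2] := fN ((e / 2) ^+ 2 / (4 * K)).
  by rewrite divr_gt0 ?mulr_gt0 ?exprn_gt0//; lra.
pose n := maxn N1 N2.
apply: le_lt_trans (dist2_triangle (hyp_l2 (g x)) (hyp_l2 (g (f n))) lu) _.
have : dist2 (g x) (g (f n)) < e / 2.
  by apply: gd2 => //; [lra|apply: h2; exact: leq_maxr].
have := h1 n (leq_maxl _ _); lra.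
Qed.

Lemma isom_cd g : Defs.isometry g -> forall x y, cd (g x) (g y) = cd x y.
Proof. by move=> [_ h] x y; rewrite -!cosh_hdist h. Qed.

(** Minimality of the hull is applied to the preimage of [C] under [g]. That this preimage
    accumulates at a limit point [xi] is seen at the image [xi'], again a limit point, and pulled
    back by the inverse [k]. *)
Lemma convex_hull_invariant o (G : set (hyp R d -> hyp R d)) (C : set (hyp R d)) g :
  isometry_group G -> is_convex_hull (limit_set o G) C -> G g ->
  forall x, C x -> C (g x).
Proof.
move=> [isoG _ compG invG] [clC cvC LC minC] Gg.
have [_ dg] := isoG g Gg; have ig := isom_cd (isoG g Gg).
have [k [Gk gk kg]] := invG g Gg; have ik := isom_cd (isoG k Gk).
have [K K0 hK] := lker_isom o ik.
apply: minC => [x hx|x y c Ax Ay [c0 c1 cd] t ht|xi Lxi U [e /= e0 eU]] /=.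
- apply: clC => e e0; have [a [Ca ha]] := hx e e0.
  by exists (g a); split=> //; rewrite /hball /= dg.
- apply: (cvC (g x) (g y) (g \o c)) => //; last by rewrite dg.
  split=> [||s t']; [by rewrite /= c0|by rewrite dg /= c1|].
  by rewrite !dg; exact: cd.
- have [xi' hxi'] := isom_bdry o xi ig.
  have [h [Gh hcv]] := Lxi.
  have Lxi' : limit_set o G xi'.
    exists (fun n => g \o h n); split=> [n|]; first exact: compG.
    apply/cvg_at_bdry => r r0; have [s s0 hs] := hxi' r r0.
    have [N hN] := (cvg_at_bdry _ _).1 hcv s s0.
    by exists N => n Nn; apply: hs; exact: hN.
  (* [isom_bdry] for [k] at [xi'] would give a boundary point still to be identified with [xi].
     Comparing [k y] with an orbit point [z = k (g z)], where [z] is near [xi] and [g z] near [xi'],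
     avoids this. *)
  have [r r0 hr] : exists2 r, 0 < r & forall y, dist2 y xi' < r -> dist2 (k y) xi < e.
    exists ((e / 2) ^+ 2 / (4 * K)).
      by rewrite divr_gt0 ?mulr_gt0 ?exprn_gt0//; lra.
    move=> y hy.
    have [|s s0 hs] := hxi' ((e / 2) ^+ 2 / (4 * K)).
      by rewrite divr_gt0 ?mulr_gt0 ?exprn_gt0//; lra.
    have [|N hN] := (cvg_at_bdry _ _).1 hcv (Num.min s (e / 2)).
      by rewrite lt_min s0/=; lra.
    have := hN N (leqnn N); set z := h N o; rewrite lt_min => /andP[z1 z2].
    apply: le_lt_trans (dist2_triangle (hyp_l2 (k y)) (hyp_l2 z) (bdry_l2 xi)) _.
    suff : dist2 (k y) z < e / 2 by lra.
    rewrite -(@ltr_pXn2r _ 2) ?nnegrE ?dist2_ge0//; last lra.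
    apply: le_lt_trans (dist2_le_lker (cball_hyp _) (cball_hyp _)) _.
    have zE : z = k (g z) by rewrite gk.
    rewrite zE.
    have h1 := hK y (g z).
    have h2 := lker_le_dist2 xi' (cball_hyp y) (cball_hyp (g z)).
    have h3 := hs z z1.
    have -> : (e / 2) ^+ 2 = 2 * (K * ((e / 2) ^+ 2 / (4 * K) + (e / 2) ^+ 2 / (4 * K))).
      by field; rewrite gt_eqF.
    rewrite ltr_pM2l//; apply: le_lt_trans h1 _; rewrite ltr_pM2l//; lra.
  have [|y [Cy hy]] := LC _ Lxi' [set y | dist2 y xi' < r]; first by exists r.
  by exists (k y); split; [rewrite /= kg|apply: eU; exact: hr].
Qed.

Lemma near_bdry_far p xi M : exists2 e, 0 < e & forall x, dist2 x xi < e -> M <= cd p x.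
Proof.
have m0 : 0 < 1 - norm2 p by rewrite subr_gt0 hyp_lt1.
set m := 1 - norm2 p in m0.
exists (m ^+ 2 / (2 * (M ^+ 2 + 1))).
  by rewrite divr_gt0 ?exprn_gt0// mulr_gt0// ltr_wpDl// sqr_ge0.
move=> x hx; rewrite leNgt; apply/negP => cM.
have h1 := cd_hgt_ge x p; rewrite -/m in h1.
have h2 := lker_le_dist2 xi (cball_hyp x) (cball_hyp x).
rewrite -hgt_sqr in h2; have x0 := hgt_gt0 x.
have c0 := cd_gt0 p x; rewrite (cdC x p) in h1.
have M1 : 0 < 2 * (M ^+ 2 + 1) by rewrite mulr_gt0// ltr_wpDl// sqr_ge0.
rewrite ltr_pdivlMr// in hx.
have h3 : m <= M * hgt x by apply: le_trans h1 _; rewrite ler_pM2r// ltW.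
have h4 : m ^+ 2 <= M ^+ 2 * hgt x ^+ 2.
  by rewrite -exprMn ler_pXn2r ?nnegrE// ?ltW// (lt_le_trans m0).
have h5 : 0 <= dist2 x xi := dist2_ge0 _ _.
have h6 : M ^+ 2 * hgt x ^+ 2 <= M ^+ 2 * (dist2 x xi + dist2 x xi).
  by rewrite ler_wpM2l// sqr_ge0.
lra.
Qed.

(** Gromov products stay bounded near two distinct boundary points: [lker x y] is bounded below
    there, while [lker p x] and [lker p y] never exceed 2. *)
Lemma near_bdry_apart p xi eta : xi <> eta -> exists e delta, [/\ 0 < e, 0 < delta &
  forall x y, dist2 x xi < e -> dist2 y eta < e -> delta * (cd p x * cd p y) <= cd x y].
Proof.
move=> xe; have lx := bdry_l2 xi; have le := bdry_l2 eta.
have D0 : 0 < dist2 xi eta.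
  rewrite lt_def dist2_ge0 andbT; apply/eqP => D0; apply: xe.
  apply/bdry_inj/funext => i; have lb := in_l2B lx le.
  have := sqr_le_dotp i lb; rewrite -(norm2_sqr lb) -/(dist2 xi eta) D0 expr0n/=.
  move=> h; have : (xi i - eta i) ^+ 2 = 0 by apply/eqP; rewrite eq_le h sqr_ge0.
  by move/eqP; rewrite sqrf_eq0 subr_eq0 => /eqP.
set D := dist2 xi eta in D0.
have p0 := lker_hyp_gt0 p; rewrite -hgt_sqr in p0.
exists (D / 4), (D ^+ 2 / 8 * hgt p ^+ 2 / 4); split; first lra.
  by rewrite divr_gt0// mulr_gt0// divr_gt0// exprn_gt0.
move=> x y hx hy.
have h1 : D / 2 <= dist2 x y.
  have := dist2_triangle lx (hyp_l2 x) le.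
  have := dist2_triangle (hyp_l2 x) (hyp_l2 y) le.
  rewrite -/D (dist2C xi x); lra.
have h2 := dist2_le_lker (cball_hyp x) (cball_hyp y).
have h3 : D ^+ 2 / 8 <= lker x y by nra.
have x2 := lker_le2 (cball_hyp p) (cball_hyp x).
have y2 := lker_le2 (cball_hyp p) (cball_hyp y).
have hx0 := hgt_gt0 x; have hy0 := hgt_gt0 y; have hp0 := hgt_gt0 p.
rewrite -(@ler_pM2r _ (hgt x * hgt y)) ?mulr_gt0//.
have -> : cd x y * (hgt x * hgt y) = lker x y by rewrite -lker_cd.
have -> : D ^+ 2 / 8 * hgt p ^+ 2 / 4 * (cd p x * cd p y) * (hgt x * hgt y) =
   D ^+ 2 / 8 * (lker p x * lker p y / 4) by rewrite !lker_cd; ring.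
apply: le_trans h3; rewrite ler_piMr//; first by rewrite divr_ge0// sqr_ge0.
rewrite ler_pdivrMr// mul1r.
have a0 := lker_gt0 x (cball_hyp p); have b0 := lker_gt0 y (cball_hyp p).
nra.
Qed.

End Isometries.

(** * The coarse argument *)

Section FiniteSets.
Context {R : realType}.

Lemma finite_set_rel (T U : Type) (A : set T) (B : set U) (r : T -> U -> Prop) :
  (forall x, A x -> exists2 u, B u & r x u) ->
  (forall x y u, A x -> A y -> r x u -> r y u -> x = y) ->
  finite_set B -> finite_set A.
Proof.
move=> Ar rI fB.
apply: (@sub_finite_set _ _ (\bigcup_(u in B) [set x | A x /\ r x u])).
  by move=> x Ax; have [u Bu rxu] := Ar x Ax; exists u.
apply: bigcup_finite => // u _.
have [[x [Ax rx]]|h] := pselect (exists x, A x /\ r x u); last first.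
  by apply: (@sub_finite_set _ _ set0) => // x hx; apply: h; exists x.
apply: (@sub_finite_set _ _ [set x]); last exact: finite_set1.
by move=> y [Ay ry]; exact: (rI y x u).
Qed.

Lemma finite_set_ub (T : Type) (A : set T) (f : T -> R) : finite_set A ->
  exists M, forall x, A x -> f x <= M.
Proof.
move=> /(finite_image f)/finite_seqP[s sE].
have [M hM] : exists M, forall r, r \in s -> r <= M.
  elim: s {sE} => [|a s [M hM]]; first by exists 0.
  exists (Num.max a M) => r; rewrite inE => /orP[/eqP->|rs].
    by rewrite le_max lexx.
  by rewrite le_max hM ?orbT.
exists M => x Ax; apply: hM.
suff : (f @` A) (f x) by rewrite sE.
by exists x.
Qed.

Lemma infinite_set_seq (T : Type) (A : set T) (n : nat) : infinite_set A ->
  exists f : nat -> T, (forall i, (i < n)%N -> A (f i)) /\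
    forall i j, (i < n)%N -> (j < n)%N -> f i = f j -> i = j.
Proof.
move=> iA; elim: n => [|n [f [fA fI]]].
  have [x Ax] : exists x, A x.
    apply: contrapT => h; apply: iA; apply: (@sub_finite_set _ _ set0) => // x Ax.
    by apply: h; exists x.
  by exists (fun=> x).
have [x [Ax hx]] : exists x, A x /\ forall i, (i < n)%N -> f i <> x.
  apply: contrapT => h; apply: iA; apply: (@sub_finite_set _ _ (f @` `I_n)).
    move=> x Ax; apply: contrapT => h'; apply: h; exists x; split=> // i ni fx.
    by apply: h'; exists i.
  exact: finite_image.
exists (fun i => if (i < n)%N then f i else x); split=> [i|i j].
  by case: ifP => // hi _; exact: fA.
rewrite !ltnS => hi hj; case: ifP => ni; case: ifP => nj.
- exact: fI.
- by move=> /(hx _ ni).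
- by move=> /esym/(hx _ nj).
- by move=> _; apply/eqP; rewrite eqn_leq; lia.
Qed.

End FiniteSets.

Section Coarse.
(* Model: c is cosh of the hyperbolic distance, and F consists of the functions
   e^(Busemann function), scaled so that the horoball is [b < 1]. *)
Context (R : realType) (X : Type) (c : X -> X -> R).
Hypothesis cC : forall x y, c x y = c y x.
Hypothesis cxx : forall x, c x x = 1.
Hypothesis c1 : forall x y, 1 <= c x y.
Hypothesis c_ptolemy : forall x y z w,
  c x z * c y w <= 2 * (c x y * c z w + c y z * c x w).

Lemma c_gt0 x y : 0 < c x y. Proof. exact: lt_le_trans ltr01 (c1 x y). Qed.

#[local] Hint Resolve c_gt0 : core.

Lemma c_tri x y z : c x z <= 4 * c x y * c y z.
Proof. by have := c_ptolemy x y z y; rewrite cxx (cC z y); lra. Qed.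

(* c(x,z) / (c(y,x) c(y,z)) is comparable to exp(-2 (x|z)_y), where (x|z)_y is the
   Gromov product, so lower bounds for it say that x and z are separated as seen
   from y. *)
Lemma sep_on_segments y z1 z2 x1 x2 delta : 0 < delta ->
  c y x1 * c x1 z1 <= c y z1 -> c y x2 * c x2 z2 <= c y z2 ->
  delta * (c y z1 * c y z2) <= c z1 z2 ->
  16 <= delta * c y x1 ^+ 2 -> 16 <= delta * c y x2 ^+ 2 ->
  delta * (c y x1 * c y x2) <= 8 * c x1 x2.
Proof.
move=> d0 s1 s2 sz h1 h2.
have := c_ptolemy z1 x1 z2 y; have := c_ptolemy x1 x2 z2 y.
rewrite (cC z1 x1) (cC z2 y) (cC z1 y) (cC x1 y) (cC x2 y).
have a0 := c_gt0 y x1; have b0 := c_gt0 y x2; have u0 := c_gt0 y z1; have v0 := c_gt0 y z2.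
have w0 := c_gt0 x1 x2.
set a := c y x1 in s1 h1 a0 *; set b := c y x2 in s2 h2 b0 *.
set u := c y z1 in s1 sz u0 *; set v := c y z2 in s2 sz v0 *.
set p := c x1 z1 in s1 *; set q := c x2 z2 in s2 *.
set w := c x1 x2 in w0 *; set r := c x1 z2; set z := c z1 z2 in sz *.
move=> hr hz.
have e1 : a ^+ 2 * b * z <= 2 * (u * v * b + 2 * a * u * (w * v + q * a)).
  have : a * b * (z * a) <= a * b * (2 * (p * v + r * u)) by rewrite ler_pM2l ?mulr_gt0.
  have : a * u * (r * b) <= a * u * (2 * (w * v + q * a)) by rewrite ler_pM2l ?mulr_gt0.
  have : b * v * (a * p) <= b * v * u by rewrite ler_pM2l ?mulr_gt0.
  lra.
have e2 : a ^+ 2 * b ^+ 2 * z <= u * v * (2 * b ^+ 2 + 4 * a * b * w + 4 * a ^+ 2).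
  have : b * (a ^+ 2 * b * z) <= b * (2 * (u * v * b + 2 * a * u * (w * v + q * a))).
    by rewrite ler_pM2l.
  have : a ^+ 2 * u * (b * q) <= a ^+ 2 * u * v by rewrite ler_pM2l ?mulr_gt0 ?exprn_gt0.
  lra.
have e3 : u * v * (a ^+ 2 * b ^+ 2 * delta) <=
          u * v * (2 * b ^+ 2 + 4 * a * b * w + 4 * a ^+ 2).
  apply: le_trans e2.
  have : a ^+ 2 * b ^+ 2 * (delta * (u * v)) <= a ^+ 2 * b ^+ 2 * z.
    by rewrite ler_pM2l ?mulr_gt0 ?exprn_gt0.
  lra.
rewrite ler_pM2l ?mulr_gt0// in e3.
(* The bounds by 16 make [2 * b^2 + 4 * a^2] at most 3/8 of the left side of [e3], up to the factor
   [u * v]; the term in [w] carries the rest. *)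
have e4 : 16 * b ^+ 2 <= delta * a ^+ 2 * b ^+ 2 by rewrite ler_pM2r ?exprn_gt0.
have e5 : 16 * a ^+ 2 <= delta * b ^+ 2 * a ^+ 2 by rewrite ler_pM2r ?exprn_gt0.
have e6 : a * b * (delta * (a * b)) <= a * b * (8 * w) by nra.
by rewrite ler_pM2l ?mulr_gt0 in e6.
Qed.

(** In the application [C] is the convex hull, [A i] the part of it near the [i]-th of three limit
    points, and [s0] the cosh-radius of a neighbourhood of [G1 p]. *)
Variables (C : set X) (p : X) (G1 G2 : set (X -> X)) (F : set (X -> R)).
Variables (s0 delta : R) (A : 'I_3 -> set X).
Hypothesis Cp : C p.
Hypothesis G1M : forall g h, G1 g -> G1 h -> G1 (g \o h).
Hypothesis G1V : forall g, G1 g -> exists h, [/\ G1 h, cancel g h & cancel h g].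
Hypothesis G2M : forall g h, G2 g -> G2 h -> G2 (g \o h).
Hypothesis G2V : forall g, G2 g -> exists h, [/\ G2 h, cancel g h & cancel h g].
Hypothesis G12 : G1 `<=` G2.
Hypothesis G2c : forall g x y, G2 g -> c (g x) (g y) = c x y.
Hypothesis CG : forall g x, G2 g -> C x -> C (g x).
Hypothesis discrete : forall M, finite_set [set g | G2 g /\ c p (g p) <= M].
Hypothesis F0 : forall b x, F b -> 0 < b x.
Hypothesis F_ptolemy : forall b x y z, F b ->
  c x z * b y <= 2 * (c x y * b z + c y z * b x).
Hypothesis F_G1 : forall b k, F b -> G1 k -> F (b \o k).
(** The first alternative identifies the horoballs only as sets and does not give [b = b'];
    [same_horoball] compares such functions. The second is what disjointness amounts to. *)
Hypothesis F_disj : forall b b', F b -> F b' ->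
  [set x | b x < 1] = [set x | b' x < 1] \/
  forall z w, c z w <= b z * b' w + b' z * b w.
Hypothesis s01 : 1 <= s0.
Hypothesis F_exit : forall b y z, F b -> C y -> C z -> b y < 1 -> 1 <= b z ->
  exists x k, [/\ C x, G1 k, b x = 1, c y x * c x z <= c y z & c x (k p) <= s0].
Hypothesis F_cover : forall x, C x ->
  (exists2 k, G1 k & c x (k p) <= s0) \/ (exists2 b, F b & b x < 1).
Hypothesis d0 : 0 < delta.
Hypothesis AC : forall i, A i `<=` C.
Hypothesis A_far : forall i M, exists2 x, A i x & M <= c p x.
Hypothesis A_sep : forall i j x y, i != j -> A i x -> A j y ->
  delta * (c p x * c p y) <= c x y.

Lemma F_lip b x y : F b -> b x <= 4 * c x y * b y.
Proof. by move=> Fb; have := F_ptolemy y x y Fb; rewrite cxx (cC y x); lra. Qed.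

Lemma other_ord3 (i : 'I_3) : exists j k : 'I_3, [/\ j != i, k != i & j != k].
Proof.
case: i => [[|[|[|//]]] hi].
- by exists (@Ordinal 3 1 isT), (@Ordinal 3 2 isT).
- by exists (@Ordinal 3 0 isT), (@Ordinal 3 2 isT).
- by exists (@Ordinal 3 0 isT), (@Ordinal 3 1 isT).
Qed.

(* At most one of the three directions points towards the centre of a horoball. *)
Lemma good_directions b g : F b -> G2 g -> exists i j : 'I_3, [/\ i != j,
  forall x, A i x -> delta / 4 * (c p x * b (g p)) <= b (g x) &
  forall x, A j x -> delta / 4 * (c p x * b (g p)) <= b (g x)].
Proof.
move=> Fb Gg.
pose good i := forall x, A i x -> delta / 4 * (c p x * b (g p)) <= b (g x).
suff [i hi] : exists i, forall j, j != i -> good j.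
  by have [j [k [ji ki jk]]] := other_ord3 i; exists j, k; split=> //; exact: hi.
have [h|/existsNP[i /existsNP[x /not_implyP[Aix /negP]]]] :=
    pselect (forall i, good i).
  by exists ord0 => j _; exact: h.
rewrite -ltNge => hx; exists i => j ji y Ajy.
rewrite leNgt; apply/negP => hy.
have h1 := F_ptolemy (g x) (g p) (g y) Fb.
rewrite !G2c// (cC x p) in h1.
have h2 := A_sep ji Ajy Aix; rewrite (cC y x) in h2.
have b0 := F0 (g p) Fb; have x0 := c_gt0 p x; have y0 := c_gt0 p y.
have h3 : c p x * b (g y) < c p x * (delta / 4 * (c p y * b (g p))) by rewrite ltr_pM2l.
have h4 : c p y * b (g x) < c p y * (delta / 4 * (c p x * b (g p))) by rewrite ltr_pM2l.
have h5 : delta * (c p y * c p x) * b (g p) <= c x y * b (g p) by rewrite ler_pM2r.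
lra.
Qed.

Definition kexit := locked (16 / delta).

Lemma kexitE : kexit = 16 / delta. Proof. by rewrite /kexit -lock. Qed.

(** Along each of two good directions [b] reaches 1, so a geodesic exits. At the exit [x] the
    inequality for [b] gives [c (g p) x * b (g a) <= 4 * c (g p) (g a)], and goodness gives [b (g a)
    >= delta / 4 * c (g p) (g a) * b (g p)]; hence the constant [16 / delta]. *)
Lemma exit_pair b g : F b -> G2 g -> b (g p) < 1 ->
  exists z1 z2 x1 x2 k1 k2,
  [/\ delta * (c (g p) z1 * c (g p) z2) <= c z1 z2,
   [/\ G1 k1, b x1 = 1, c x1 (k1 p) <= s0, c (g p) x1 * c x1 z1 <= c (g p) z1 &
       c (g p) x1 * b (g p) <= kexit] &
   [/\ G1 k2, b x2 = 1, c x2 (k2 p) <= s0, c (g p) x2 * c x2 z2 <= c (g p) z2 &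
       c (g p) x2 * b (g p) <= kexit]].
Proof.
move=> Fb Gg b1; have [i [j [ij gi gj]]] := good_directions Fb Gg.
have b0 := F0 (g p) Fb.
have one l : (forall x, A l x -> delta / 4 * (c p x * b (g p)) <= b (g x)) ->
   exists a x k, [/\ A l a, G1 k, b x = 1, c x (k p) <= s0 &
     c (g p) x * c x (g a) <= c (g p) (g a) /\ c (g p) x * b (g p) <= kexit].
  move=> gl; have [a Aa ha] := A_far l (4 / (delta * b (g p))).
  have bz : 1 <= b (g a).
    apply: le_trans (gl a Aa).
    have : 4 / (delta * b (g p)) * (delta / 4 * b (g p)) <= c p a * (delta / 4 * b (g p)).
      by rewrite ler_pM2r// mulr_gt0// divr_gt0//; lra.
    have -> : 4 / (delta * b (g p)) * (delta / 4 * b (g p)) = 1.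
      by field; rewrite !gt_eqF.
    lra.
  have [x [k [Cx Gk bx sx ck]]] := F_exit Fb (CG Gg Cp) (CG Gg (AC Aa)) b1 bz.
  exists a, x, k; split=> //; split=> //.
  have h := F_ptolemy (g p) (g a) x Fb; rewrite bx in h.
  have h1 := gl a Aa; rewrite -(G2c p a Gg) in h1.
  rewrite (cC (g a) x) in h.
  have y0 := c_gt0 (g p) x; have z0 := c_gt0 (g p) (g a).
  set u := c (g p) x in h sx y0 *; set v := c (g p) (g a) in h h1 sx z0 *.
  set w := c x (g a) in h sx *; set e := b (g p) in b0 b1 h h1 *.
  have u1 : 1 <= u by exact: c1.
  have w1 : w <= v by have := c_gt0 x (g a); rewrite -/w; nra.
  have h2 : u * (delta / 4 * (v * e)) <= u * b (g a) by rewrite ler_pM2l.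
  have h3 : w * e <= v by have := c_gt0 x (g a); rewrite -/w; nra.
  have h4 : v * (u * e) <= v * kexit.
    rewrite kexitE; have -> : v * (16 / delta) = (4 * v) / (delta / 4).
      by field; rewrite gt_eqF.
    by have dp := d0; rewrite ler_pdivlMr; lra.
  by rewrite ler_pM2l in h4.
have [a1 [x1 [k1 [A1 G1k1 bx1 cx1 [s1 m1]]]]] := one i gi.
have [a2 [x2 [k2 [A2 G1k2 bx2 cx2 [s2 m2]]]]] := one j gj.
exists (g a1), (g a2), x1, x2, k1, k2; split=> //.
by rewrite !G2c//; exact: A_sep ij _ _.
Qed.

Lemma kexit_gt0 : 0 < kexit. Proof. by rewrite kexitE divr_gt0. Qed.

(* Two defining functions of the same horoball are comparable at the deep orbit
   points, because each such point is close to the complement of the horoball. *)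
Lemma same_horoball b b' g : F b -> F b' -> G2 g -> b (g p) < 1 ->
  [set x | b x < 1] = [set x | b' x < 1] -> b (g p) <= 4 * kexit * b' (g p).
Proof.
move=> Fb Fb' Gg b1 bb'.
have [z1 [z2 [x1 [x2 [k1 [k2 [_ [_ bx _ _ m1] _]]]]]]] := exit_pair Fb Gg b1.
have b'x : 1 <= b' x1.
  rewrite leNgt; apply/negP => h.
  have : [set x | b x < 1] x1 by rewrite bb'.
  by rewrite /= bx ltxx.
have h := F_lip x1 (g p) Fb'; rewrite (cC x1) in h.
have b0 := F0 (g p) Fb; have b'0 := F0 (g p) Fb'.
have : b (g p) * 1 <= b (g p) * (4 * c (g p) x1 * b' (g p)) by rewrite ler_pM2l//; lra.
have : b' (g p) * (c (g p) x1 * b (g p)) <= b' (g p) * kexit by rewrite ler_pM2l.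
lra.
Qed.

(** By [F_lip], a point within [s0] of the horosphere [b = 1] has [b] between [1 / (4 * s0)] and
    [4 * s0]. *)
Definition ktouch := locked (4 * s0).

Lemma ktouchE : ktouch = 4 * s0. Proof. by rewrite /ktouch -lock. Qed.

Lemma ktouch_ge4 : 4 <= ktouch. Proof. by have := s01; rewrite ktouchE; lra. Qed.

(** [p] lies within bounded distance of the horosphere [b = 1], on either side. *)
Definition touching b := 1 <= ktouch * b p /\ b p <= ktouch.

Lemma exit_touching b x k : F b -> G1 k -> b x = 1 -> c x (k p) <= s0 -> touching (b \o k).
Proof.
have s1 := s01.
move=> Fb Gk bx cx; rewrite /touching/=.
have h1 := F_lip x (k p) Fb; have h2 := F_lip (k p) x Fb.
rewrite bx in h1 h2; rewrite (cC _ x) in h2.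
by have := F0 (k p) Fb; rewrite ktouchE => b0; split; nra.
Qed.

Lemma bounded_case (tau : R) : 0 < tau ->
  (forall b g, F b -> G2 g -> tau <= b (g p)) ->
  exists M, forall g, G2 g -> exists2 k, G1 k & c (k p) (g p) <= M.
Proof.
have s1 := s01; have em := kexit_gt0.
move=> t0 ht; exists (s0 + 4 * (kexit / tau) * s0) => g Gg.
have m0 : 0 < 4 * (kexit / tau) * s0 by rewrite !mulr_gt0 ?invr_gt0//; lra.
have [[k Gk ck]|[b Fb b1]] := F_cover (CG Gg Cp).
  by exists k => //; rewrite cC; lra.
have [z1 [z2 [x [x2 [k [k2 [_ [Gk bx ck _ m1] _]]]]]]] := exit_pair Fb Gg b1.
exists k => //.
have h1 : c (g p) x <= kexit / tau.
  rewrite ler_pdivlMr//; apply: le_trans m1.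
  by rewrite ler_pM2l; [exact: (ht b g)|exact: c_gt0].
have h2 := c_tri (k p) x (g p).
rewrite (cC (k p) x) (cC x (g p)) in h2.
have h3 : c x (k p) * c (g p) x <= s0 * (kexit / tau).
  by apply: ler_pM => //; exact: ltW.
by lra.
Qed.

(** Bound for [c p (g p) * b (g p)]. When [b p] is about 1, such a bound says that [g p] is close to
    the ray from [p] to the centre of the horoball. *)
Definition knorm := 4 * s0 * kexit.

(** * Orbit points of unbounded depth *)

Section Deep.
Hypothesis deep : forall tau, 0 < tau -> exists b g, [/\ F b, G2 g & b (g p) < tau].

(** The exit from the horoball is near some [k p] with [k] in [G1]; translating everything by the
    inverse of [k] brings it near [p]. *)
Lemma deep_touching tau : 0 < tau -> exists b g,
  [/\ F b, G2 g, touching b, b (g p) < tau & c p (g p) * b (g p) <= knorm].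
Proof.
move=> t0; have [|b [g [Fb Gg]]] := deep (tau := Num.min tau 1).
  by rewrite lt_min t0/=.
rewrite lt_min => /andP[bt b1].
have [z1 [z2 [x [x2 [k [k2 [_ [Gk bx ck _ m1] _]]]]]]] := exit_pair Fb Gg b1.
have [h [Gh kh hk]] := G1V Gk.
exists (b \o k), (h \o g); split=> //.
- exact: F_G1.
- by apply: G2M => //; exact: G12.
- exact: exit_touching Fb Gk bx ck.
- by rewrite /= hk.
- rewrite /= hk -(G2c _ _ (G12 Gk)) hk.
  have h2 := c_tri (k p) x (g p).
  rewrite (cC (k p) x) (cC x (g p)) in h2.
  have b0 := F0 (g p) Fb.
  have h3 : c (k p) (g p) * b (g p) <= 4 * c x (k p) * c (g p) x * b (g p).
    by rewrite ler_pM2r.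
  have h4 : c x (k p) * (c (g p) x * b (g p)) <= s0 * kexit.
    by apply: ler_pM => //; rewrite ?mulr_ge0// ltW.
  rewrite /knorm; lra.
Qed.

(** Since [1 <= ktouch * b p] and [b p <= 4 * c p (g p) * b (g p)], this depth forces
    [c p (g p) >= 16 * ktouch^2], far enough to apply [sep_on_segments]. *)
Definition depth0 := 1 / (64 * ktouch ^+ 3).

Lemma depth0_gt0 : 0 < depth0.
Proof.
have A4 := ktouch_ge4.
by rewrite /depth0 divr_gt0// mulr_gt0// exprn_gt0//; lra.
Qed.

Lemma depth0E : 64 * ktouch ^+ 3 * depth0 = 1.
Proof.
have A4 := ktouch_ge4.
by rewrite /depth0; field; rewrite gt_eqF//; lra.
Qed.

Lemma depth0_le : depth0 * ktouch <= 1 / 2.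
Proof.
have A4 := ktouch_ge4.
have -> : depth0 * ktouch = 1 / (64 * ktouch ^+ 2).
  by rewrite /depth0; field; rewrite gt_eqF//; lra.
rewrite ler_pdivrMr; first by nra.
by rewrite mulr_gt0// exprn_gt0//; lra.
Qed.

Lemma deep_far b g : F b -> touching b -> b (g p) < depth0 -> 16 * ktouch ^+ 2 <= c p (g p).
Proof.
have A4 := ktouch_ge4; have Ap : 0 < ktouch by lra.
move=> Fb [n1 _] bt; have h := F_lip p (g p) Fb.
have b0 := F0 (g p) Fb; have cp := c_gt0 p (g p).
have h1 : ktouch * b p <= ktouch * (4 * c p (g p) * b (g p)) by rewrite ler_pM2l//; lra.
have h2 : ktouch * 4 * c p (g p) * b (g p) <= ktouch * 4 * c p (g p) * depth0.
  by rewrite ler_pM2l ?(ltW bt)// !mulr_gt0//; lra.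
have h3 : 64 * ktouch ^+ 3 * 1 <= 64 * ktouch ^+ 3 * (ktouch * 4 * c p (g p) * depth0).
  by rewrite ler_pM2l; [lra|rewrite mulr_gt0// exprn_gt0//; lra].
have h4 : 64 * ktouch ^+ 3 * (ktouch * 4 * c p (g p) * depth0) = ktouch * 4 * c p (g p).
  by rewrite -[RHS]mul1r -[X in _ = X * _]depth0E; ring.
rewrite h4 in h3.
have : ktouch * (64 * ktouch ^+ 2) <= ktouch * (4 * c p (g p)) by lra.
rewrite ler_pM2l; lra.
Qed.

(** As [b (g p)] is tiny, [F_disj] at [g p] and [p] forces [b' (g p)] to be at least
    [c p (g p) / (2 * ktouch)]. As [b' (g' p)] is tiny too, the four-point inequality for [b']
    separates [g p] from [g' p] as seen from [p]. *)
Lemma deep_sep b b' g g' : F b -> F b' -> touching b -> touching b' ->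
  [set x | b x < 1] <> [set x | b' x < 1] ->
  b (g p) < depth0 -> b' (g' p) < depth0 ->
  1 / (8 * ktouch ^+ 2) * (c p (g p) * c p (g' p)) <= c (g p) (g' p).
Proof.
have A4 := ktouch_ge4; have Ap : 0 < ktouch by lra.
have tle := depth0_le; have tp := depth0_gt0.
move=> Fb Fb' nb nb' bb' bt b't.
have [//|disj] := F_disj Fb Fb'.
have [_ bp] := nb; have [_ b'p] := nb'.
have far' := deep_far Fb' nb' b't.
have h1 := disj (g p) p; rewrite cC in h1.
have u0 := c_gt0 p (g p); have v0 := c_gt0 p (g' p); have u1 := c1 p (g p).
have bg0 := F0 (g p) Fb; have bg'0 := F0 (g' p) Fb'; have b'g0 := F0 (g p) Fb'.
have bp0 := F0 p Fb; have b'p0 := F0 p Fb'.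
have w0 := c_gt0 (g p) (g' p).
have h3 := F_ptolemy p (g p) (g' p) Fb'.
set u := c p (g p) in h1 h3 u0 u1 *; set v := c p (g' p) in h3 v0 far' *.
set w := c (g p) (g' p) in h3 w0 *.
have q1 : b (g p) * b' p <= depth0 * ktouch by apply: ler_pM => //; exact: ltW.
have q2 : b' (g p) * b p <= b' (g p) * ktouch by rewrite ler_pM2l.
have q3 : u <= 2 * ktouch * b' (g p) by lra.
have q4 : v * u <= v * (2 * ktouch * b' (g p)) by rewrite ler_pM2l.
have q5 : ktouch * (v * b' (g p)) <= ktouch * (2 * (u * b' (g' p) + w * b' p)).
  by rewrite ler_pM2l//; lra.
have q6 : u * b' (g' p) <= u * depth0 by rewrite ler_pM2l// ltW.
have q7 : w * b' p <= w * ktouch by rewrite ler_pM2l.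
have q8 : u * depth0 * (16 * ktouch ^+ 2) <= u * depth0 * v by rewrite ler_pM2l// mulr_gt0.
have q9 : v * u <= 4 * ktouch * (u * depth0) + 4 * ktouch ^+ 2 * w.
  have : ktouch * (u * b' (g' p)) <= ktouch * (u * depth0) by rewrite ler_pM2l//; lra.
  have : ktouch * (w * b' p) <= ktouch * (w * ktouch) by rewrite ler_pM2l//; lra.
  lra.
have q10 : ktouch * (u * depth0) <= u * v / 32.
  have : u * (depth0 * ktouch) <= u * (1 / 2) by rewrite ler_pM2l.
  have : u * 16 <= u * v by rewrite ler_pM2l//; nra.
  lra.
have q11 : 0 < w * ktouch ^+ 2 by rewrite mulr_gt0// exprn_gt0//; lra.
rewrite mulrAC mul1r ler_pdivrMr; first lra.
by rewrite mulr_gt0// exprn_gt0//; lra.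
Qed.

(** Sets are counted rather than functions, since [F] may contain several functions for one
    horoball. *)
Definition deep_horoballs : set (set X) := [set B | exists b g,
  [/\ F b, G2 g, touching b, b (g p) < depth0 & B = [set x | b x < 1]]].

(* Seen from an orbit point y deep inside one horoball, the deep points of the
   others lie in well separated directions, and all but one of these directions
   leave the first horoball at a bounded distance from y, close to one of finitely
   many orbit points. *)
Lemma finite_deep_horoballs : finite_set deep_horoballs.
Proof.
have s1 := s01; have A4 := ktouch_ge4; have Ap : 0 < ktouch by lra.
have tle := depth0_le; have tp := depth0_gt0.
have [b1 [g1 [Fb1 Gg1 nb1 bt1 _]]] := deep_touching depth0_gt0.
pose y := g1 p.
have y0 : 0 < b1 y := F0 y Fb1.
(* For two points [x], [x'] with [b1 <= 1], separated as in [sep], the inequality for [b1] reads [D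
   * c y x * c y x' <= 2 * (c y x + c y x')] with [D = 16 / M4]. So they cannot both be beyond [M4],
   and at most one horoball is not [good]. *)
pose M4 := 16 / (1 / (64 * ktouch ^+ 2) * b1 y).
(* [x] is the exit from the first horoball on the way from [y] to [z], or [z] itself if [z] still
   lies inside; either way the orbit point [h p] is near. *)
pose data B x h := exists b g z, [/\ [/\ F b, G2 g, touching b, b (g p) < depth0 &
    B = [set x | b x < 1]],
  z = g1 (g p), c y x * c x z <= c y z, 16 * ktouch ^+ 2 <= c y x &
  [/\ b1 x <= 1, G2 h & c x (h p) <= s0]].
have dataP B : deep_horoballs B -> exists x h, data B x h.
  move=> [b [g [Fb Gg nb bt ->]]]; pose z := g1 (g p).
  have Cz : C z by apply: CG => //; exact: CG.
  have [bz|bz] := ltP (b1 z) 1.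
    exists z, (g1 \o g), b, g, z; split=> //; rewrite ?cxx ?mulr1//.
      by rewrite G2c//; exact: deep_far nb bt.
    by split=> //; [exact: ltW|exact: G2M].
  have b1y : b1 y < 1 by have := depth0_le; have := bt1; rewrite -/y; nra.
  have [x [k [Cx Gk bx sx ck]]] := F_exit Fb1 (CG Gg1 Cp) Cz b1y bz.
  exists x, k, b, g, z; split=> //.
    have h := F_lip x y Fb1; rewrite bx (cC x) in h.
    have cy := c_gt0 y x.
    have h1 : 4 * c y x * b1 y <= 4 * c y x * depth0 by rewrite ler_pM2l ?mulr_gt0// ltW.
    have h2 : 64 * ktouch ^+ 3 * 1 <= 64 * ktouch ^+ 3 * (4 * c y x * depth0).
      by rewrite ler_pM2l; [lra|rewrite mulr_gt0// exprn_gt0//; lra].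
    have h3 : 64 * ktouch ^+ 3 * (4 * c y x * depth0) = 4 * c y x.
      by rewrite -[RHS]mul1r -[X in _ = X * _]depth0E; ring.
    rewrite h3 in h2.
    have : 1 * ktouch ^+ 2 <= ktouch * ktouch ^+ 2 by rewrite ler_pM2r ?exprn_gt0//; lra.
    lra.
  by split=> //; [rewrite bx|exact: G12].
have A20 : 0 < ktouch ^+ 2 by rewrite exprn_gt0//; lra.
have sep B B' x x' h h' : data B x h -> data B' x' h' -> B <> B' ->
    1 / (64 * ktouch ^+ 2) * (c y x * c y x') <= c x x'.
  move=> [b [g [z [[Fb Gg nb bt BE] zE sx fx _]]]].
  move=> [b' [g' [z' [[Fb' Gg' nb' bt' BE'] zE' sx' fx' _]]]] BB'.
  have szz : 1 / (8 * ktouch ^+ 2) * (c y z * c y z') <= c z z'.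
    rewrite zE zE' !G2c//; apply: (deep_sep Fb Fb') => //.
    by rewrite -BE -BE'.
  have D8 : 0 < 1 / (8 * ktouch ^+ 2) by rewrite divr_gt0// mulr_gt0.
  have sqb r : 16 * ktouch ^+ 2 <= r -> 16 <= 1 / (8 * ktouch ^+ 2) * r ^+ 2.
    move=> hr; rewrite mulrAC mul1r ler_pdivlMr ?mulr_gt0//.
    have A2 : 16 <= ktouch ^+ 2 by nra.
    have : (16 * ktouch ^+ 2) ^+ 2 <= r ^+ 2 by rewrite ler_pXn2r ?nnegrE//; lra.
    have : ktouch ^+ 2 * 16 <= ktouch ^+ 2 * ktouch ^+ 2 by rewrite ler_pM2l.
    lra.
  have := sep_on_segments D8 sx sx' szz (sqb _ fx) (sqb _ fx').
  have -> : 1 / (64 * ktouch ^+ 2) = 1 / (8 * ktouch ^+ 2) / 8.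
    by field; rewrite gt_eqF//; lra.
  lra.
pose good B := exists x h, data B x h /\ c y x <= M4.
have fgood : finite_set [set B | deep_horoballs B /\ good B].
  apply: (finite_set_rel (B := [set h | G2 h /\ c p (h p) <= 16 * c p y * M4 * s0])
    (r := fun B h => exists x, data B x h)); last exact: discrete.
    move=> B [_ [x [h [dx cx]]]]; exists h; last by exists x.
    have [b [g [z [_ _ _ _ [_ Gh xh]]]]] := dx; split=> //.
    have t1 := c_tri p y (h p); have t2 := c_tri y x (h p).
    have py := c_gt0 p y.
    have t3 : 4 * c p y * c y (h p) <= 4 * c p y * (4 * c y x * c x (h p)).
      by rewrite ler_pM2l ?mulr_gt0.
    have t4 : c y x * c x (h p) <= M4 * s0 by apply: ler_pM => //; exact: ltW.
    have t5 : c p y * (c y x * c x (h p)) <= c p y * (M4 * s0) by rewrite ler_pM2l.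
    lra.
  (* Two points within [s0] of the same [h p] satisfy [c x x' <= ktouch^2 / 4], whereas [sep] gives
     at least [4 * ktouch^2]. *)
  move=> B B' h [LB _] [LB' _] [x dx] [x' dx']; apply: contrapT => BB'.
  have := sep _ _ _ _ _ _ dx dx' BB'.
  have [b [g [z [_ _ _ fx [_ Gh xh]]]]] := dx.
  have [b' [g' [z' [_ _ _ fx' [_ _ xh']]]]] := dx'.
  have t1 := c_tri x (h p) x'; rewrite (cC (h p) x') in t1.
  have t2 : c x (h p) * c x' (h p) <= s0 * s0 by apply: ler_pM => //; exact: ltW.
  have t3 : (16 * ktouch ^+ 2) * (16 * ktouch ^+ 2) <= c y x * c y x'.
    by apply: ler_pM => //; lra.
  rewrite mulrAC mul1r ler_pdivrMr ?mulr_gt0//.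
  have sE : s0 = ktouch / 4 by rewrite ktouchE; field.
  move=> t4.
  have t5 : c x x' * (64 * ktouch ^+ 2) <= (ktouch ^+ 2 / 4) * (64 * ktouch ^+ 2).
    by rewrite ler_pM2r ?mulr_gt0//; rewrite sE in t2; lra.
  have : 0 < ktouch ^+ 2 * ktouch ^+ 2 by rewrite mulr_gt0.
  lra.
have fbad : finite_set [set B | deep_horoballs B /\ ~ good B].
  apply: (finite_set_rel (B := [set tt]) (r := fun _ _ => True)) => [B _|B B' _|].
  - by exists tt.
  - move=> [LB nB] [LB' nB'] _ _; apply: contrapT => BB'.
    have [x [h dx]] := dataP B LB; have [x' [h' dx']] := dataP B' LB'.
    have cx : M4 < c y x by rewrite ltNge; apply/negP => hx; apply: nB; exists x, h.
    have cx' : M4 < c y x' by rewrite ltNge; apply/negP => hx; apply: nB'; exists x', h'.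
    have s := sep _ _ _ _ _ _ dx dx' BB'.
    have [_ [_ [_ [_ _ _ _ [bx _ _]]]]] := dx.
    have [_ [_ [_ [_ _ _ _ [bx' _ _]]]]] := dx'.
    have := F_ptolemy x y x' Fb1; rewrite (cC x y) => h1.
    have y1 := c_gt0 y x; have y2 := c_gt0 y x'.
    have q1 : c y x * b1 x' <= c y x * 1 by rewrite ler_pM2l.
    have q2 : c y x' * b1 x <= c y x' * 1 by rewrite ler_pM2l.
    pose D := 1 / (64 * ktouch ^+ 2) * b1 y.
    have D0 : 0 < D by rewrite mulr_gt0// divr_gt0// mulr_gt0.
    have q3 : D * (c y x * c y x') <= c x x' * b1 y.
      have : (1 / (64 * ktouch ^+ 2) * (c y x * c y x')) * b1 y <= c x x' * b1 y.
        by rewrite ler_pM2r.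
      by rewrite /D; lra.
    have q4 : D * (c y x * c y x') <= 2 * (c y x + c y x') by lra.
    have M4E : D * M4 = 16 by rewrite /M4 -/D; field; rewrite gt_eqF.
    have q5 : 16 * c y x' < D * c y x * c y x'.
      by rewrite ltr_pM2r// -M4E ltr_pM2l.
    have q6 : 16 * c y x < D * c y x' * c y x.
      by rewrite ltr_pM2r// -M4E ltr_pM2l.
    lra.
  - exact: finite_set1.
apply: (@sub_finite_set _ _
  ([set B | deep_horoballs B /\ good B] `|` [set B | deep_horoballs B /\ ~ good B])).
  by move=> B LB; have [gB|nB] := pselect (good B); [left|right].
by rewrite finite_setU.
Qed.

Definition kray := 4 * kexit * knorm.

(** Pigeonhole: if each of the finitely many deep horoballs failed below some threshold, a point
    deeper than all thresholds would contradict [deep_touching]. The function found for the horoball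
    may vary with the depth; fixing one costs the factor [4 * kexit] in [kray]. *)
Lemma deep_in_one : exists b0, [/\ F b0, touching b0 & forall tau, 0 < tau ->
  exists g, [/\ G2 g, b0 (g p) < tau & c p (g p) * b0 (g p) <= kray]].
Proof.
have t0' := kexit_gt0.
pose deepB B tau := exists b g, [/\ F b, G2 g, touching b, b (g p) < tau &
  c p (g p) * b (g p) <= knorm /\ B = [set x | b x < 1]].
have [B hB] : exists B, forall tau, 0 < tau -> deepB B tau.
  apply: contrapT => /forallNP h.
  have /boolp.choice[f hf] : forall B, exists r : R, 0 < r /\ ~ deepB B r.
    move=> B; have /existsNP[tau /not_implyP[tau0' ht]] := h B.
    by exists tau.
  have [M hM] := finite_set_ub (fun B => (f B)^-1) finite_deep_horoballs.
  have N0 : 0 < `|M| + 1 by apply: ltr_wpDl.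
  have [|b [g [Fb Gg nb bt cb]]] := deep_touching (tau := Num.min depth0 (`|M| + 1)^-1).
    by rewrite lt_min depth0_gt0 invr_gt0.
  move: bt; rewrite lt_min => /andP[bt bM].
  pose B := [set x | b x < 1].
  have LB : deep_horoballs B by exists b, g.
  have [f0 hf'] := hf B; apply: hf'; exists b, g; split=> //.
  apply: lt_le_trans bM _.
  have h1 := hM B LB; have h2 := ler_norm M.
  by rewrite invf_ple ?posrE//; apply: le_trans h1 _; lra.
have [b0 [g0 [Fb0 Gg0 nb0 _ [_ BE0]]]] := hB 1 ltr01.
exists b0; split=> // tau tau0'.
have [|b [g [Fb Gg nb bt [cb BE]]]] := hB (Num.min (tau / (4 * kexit)) 1).
  by rewrite lt_min ltr01 andbT divr_gt0// mulr_gt0.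
move: bt; rewrite lt_min => /andP[bt b1].
have b01 : b0 (g p) < 1.
  by have : B (g p) by [rewrite BE]; rewrite BE0.
have h := same_horoball Fb0 Fb Gg b01 (etrans (esym BE0) BE).
rewrite ltr_pdivlMr ?mulr_gt0// in bt.
have cp := c_gt0 p (g p).
exists g; split=> //; first lra.
have : c p (g p) * b0 (g p) <= c p (g p) * (4 * kexit * b (g p)) by rewrite ler_pM2l.
have : kexit * (c p (g p) * b (g p)) <= kexit * knorm by rewrite ler_pM2l.
rewrite /kray; lra.
Qed.

(** Were the set finite, its elements would move [p] by bounded amounts. But the two exits seen from
    a very deep orbit point are very far apart, and both are near points [k p] with [k] in this
    set. *)
Lemma touching_infinite b0 : F b0 -> (forall tau, 0 < tau ->
    exists g, [/\ G2 g, b0 (g p) < tau & c p (g p) * b0 (g p) <= kray]) ->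
  infinite_set [set k | [/\ G1 k, touching (b0 \o k) &
    deep_horoballs [set x | b0 (k x) < 1]]].
Proof.
have s1 := s01; have tp := depth0_gt0; have tle := depth0_le.
have A4 := ktouch_ge4; have dd := d0.
move=> Fb0 hb0 fK.
have [M hM] := finite_set_ub (fun k => c p (k p)) fK.
(* [512] is the 8 of [sep_on_segments] times one 4 for each of three uses of [c_tri]; 17 covers the
   16 that [sep_on_segments] requires. *)
pose N := 17 + 512 * s0 ^+ 2 * M ^+ 2.
have N0 : 0 <= 512 * s0 ^+ 2 * M ^+ 2 by have := sqr_ge0 (s0 * M); lra.
pose L := N / delta + 1.
have L1 : 1 <= L by rewrite /L lerDr divr_ge0 ?(ltW dd)// /N; lra.
have dL : N <= delta * L ^+ 2.
  have -> : N = delta * (L - 1) by rewrite /L; field; rewrite gt_eqF.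
  by rewrite ler_pM2l//; nra.
have [|g [Gg bt _]] := hb0 (Num.min depth0 (1 / (4 * L))).
  by rewrite lt_min tp divr_gt0// mulr_gt0//; lra.
move: bt; rewrite lt_min => /andP[bt bL].
have b1 : b0 (g p) < 1 by nra.
have y0 := F0 (g p) Fb0.
have [z1 [z2 [x1 [x2 [k1 [k2 [sz [Gk1 bx1 ck1 sx1 _] [Gk2 bx2 ck2 sx2 _]]]]]]]] :=
  exit_pair Fb0 Gg b1.
have inK k x : G1 k -> b0 x = 1 -> c x (k p) <= s0 -> c p (k p) <= M.
  move=> Gk bx ck; apply: hM.
  have nk : touching (b0 \o k) by exact: exit_touching Fb0 Gk bx ck.
  split=> //.
  have [h [Gh kh hk]] := G1V Gk.
  exists (b0 \o k), (h \o g); split=> //; first exact: F_G1.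
    by apply: G2M => //; exact: G12.
  by rewrite /= hk.
have far x : b0 x = 1 -> L <= c (g p) x.
  move=> bx; have h := F_lip x (g p) Fb0; rewrite bx (cC x) in h.
  have cy := c_gt0 (g p) x.
  have h1 : 4 * c (g p) x * b0 (g p) <= 4 * c (g p) x * (1 / (4 * L)).
    by rewrite ler_pM2l ?(ltW bL)// mulr_gt0.
  have h2 : 1 <= 4 * c (g p) x * (1 / (4 * L)) by lra.
  have e : 4 * c (g p) x * (1 / (4 * L)) = c (g p) x / L by field; rewrite gt_eqF//; lra.
  by rewrite e ler_pdivlMr ?mul1r// in h2; lra.
have f1 := far _ bx1; have f2 := far _ bx2.
have sq r : L <= r -> 16 <= delta * r ^+ 2.
  move=> hr; have : L ^+ 2 <= r ^+ 2 by rewrite ler_pXn2r ?nnegrE//; lra.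
  move=> h; have : delta * L ^+ 2 <= delta * r ^+ 2 by rewrite ler_pM2l.
  by move: dL; rewrite /N; lra.
have s := sep_on_segments dd sx1 sx2 sz (sq _ f1) (sq _ f2).
have m1 := inK _ _ Gk1 bx1 ck1; have m2 := inK _ _ Gk2 bx2 ck2.
have t1 := c_tri x1 (k1 p) x2; have t2 := c_tri (k1 p) (k2 p) x2.
have t3 := c_tri (k1 p) p (k2 p).
rewrite (cC (k2 p)) in t2; rewrite (cC (k1 p) p) in t3.
have a1 := c_gt0 x1 (k1 p); have a2 := c_gt0 x2 (k2 p); have a3 := c_gt0 p (k1 p).
have a4 := c_gt0 p (k2 p); have a5 := c_gt0 (k1 p) x2; have a6 := c_gt0 (k1 p) (k2 p).
have u1 : c p (k1 p) * c p (k2 p) <= M * M by apply: ler_pM => //; exact: ltW.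
have u2 : c (k1 p) (k2 p) * c x2 (k2 p) <= (4 * (M * M)) * s0.
  by apply: ler_pM => //; [exact: ltW|exact: ltW|lra].
have u3 : c x1 (k1 p) * c (k1 p) x2 <= s0 * (4 * (4 * (M * M) * s0)).
  by apply: ler_pM => //; [exact: ltW|exact: ltW|lra].
have u4 : L * L <= c (g p) x1 * c (g p) x2 by apply: ler_pM => //; lra.
have u5 : delta * (L * L) <= delta * (c (g p) x1 * c (g p) x2) by rewrite ler_pM2l.
move: dL; rewrite /N; lra.
Qed.

(* The infinitely many elements of G1 preserving one horoball all move its
   sufficiently deep orbit points by a bounded amount. *)
Lemma no_deep : False.
Proof.
have [b0 [Fb0 [n1 n2] hb0]] := deep_in_one.
have s1 := s01; have A4 := ktouch_ge4; have m0 := kexit_gt0.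
have Ap : 0 < ktouch by lra.
pose K := [set k | [/\ G1 k, touching (b0 \o k) & deep_horoballs [set x | b0 (k x) < 1]]].
(* Infinitely many [k] pull the horoball of [b0] back to the same [B]; composing one of them with
   the inverse of another preserves that horoball. *)
have [B [LB iB]] : exists B, deep_horoballs B /\
    infinite_set [set k | K k /\ [set x | b0 (k x) < 1] = B].
  apply: contrapT => h; apply: (touching_infinite Fb0 hb0).
  apply: (@sub_finite_set _ _
    (\bigcup_(B in deep_horoballs) [set k | K k /\ [set x | b0 (k x) < 1] = B])).
    by move=> k Kk; exists [set x | b0 (k x) < 1] => //; have [] := Kk.
  apply: bigcup_finite; first exact: finite_deep_horoballs.
  by move=> B LB; apply: contrapT => iB; apply: h; exists B.
have [k0 [[Gk0 _ _] Bk0]] : exists k, [set k | K k /\ [set x | b0 (k x) < 1] = B] k.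
  by have [f [fK _]] := infinite_set_seq 1 iB; exists (f 0%N); exact: fK.
have [h0 [Gh0 kh hk]] := G1V Gk0.
pose D0 := c p (h0 p).
have D0p : 0 < D0 := c_gt0 _ _.
have M3p : 0 < knorm by rewrite /knorm !mulr_gt0//; lra.
have M5p : 0 < kray by rewrite /kray !mulr_gt0//; lra.
(* These bounds depend on [k0] but neither on the elements [f i] nor on the depth of [g]. So [n] is
   known before [n.+1] elements are picked, and [g] may be chosen after them. *)
pose P0 := 8 * ktouch * D0 * (1 + kray * ktouch).
pose M6 := 2 * ktouch * (4 * kexit * kray + P0).
pose Phi := [set g | G2 g /\ c p (g p) <= M6].
have /finite_setP[n Pn] : finite_set Phi by exact: discrete.
have [f [fK fI]] := infinite_set_seq n.+1 iB.
have [D1 hD1] := finite_set_ub (fun i => c p (f i (h0 p))) (finite_II n.+1).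
pose D := `|D1| + 1.
have D1p : 0 < D by rewrite /D; apply: ltr_wpDl.
have hD i : (i < n.+1)%N -> c p (f i (h0 p)) <= D.
  by move=> hi; have := hD1 i hi; rewrite /D; have := ler_norm D1; lra.
(* Deep enough to make [4 * kexit * D * b0 (g p) < 1]: the displacements of [p] by the chosen
   elements become negligible. *)
pose tau := Num.min 1 (1 / (4 * kexit * D)).
have tau_gt0 : 0 < tau by rewrite lt_min ltr01 divr_gt0// !mulr_gt0.
have [g [Gg bt cb]] := hb0 tau tau_gt0.
move: bt; rewrite lt_min => /andP[b1 bD].
have y0 := F0 (g p) Fb0.
rewrite ltr_pdivlMr ?mulr_gt0// in bD.
have [hg [Ghg ghg hgg]] := G2V Gg.
have move_le i : (i < n.+1)%N -> c (g p) (f i (h0 (g p))) <= M6.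
  move=> hi; have [[Gf [nf _] _] Bf] := fK i hi.
  have D2 := hD i hi.
  have Gpi : G1 (f i \o h0) by exact: G1M.
  have Fpi : F (b0 \o (f i \o h0)) by exact: F_G1.
  have Epi : [set x | (b0 \o (f i \o h0)) x < 1] = [set x | b0 x < 1].
    apply/seteqP; split=> x /=.
      move=> hx; have : B (h0 x) by rewrite -Bf.
      by rewrite -Bk0 /= hk.
    move=> hx; have : B (h0 x) by rewrite -Bk0 /= hk.
    by rewrite -Bf.
  have b1' : (b0 \o (f i \o h0)) (g p) < 1.
    by have : [set x | (b0 \o (f i \o h0)) x < 1] (g p) by rewrite Epi.
  have e1 := same_horoball Fpi Fb0 Gg b1' Epi; rewrite /= in e1.
  have e1p : 0 < b0 (f i (h0 (g p))) by exact: F0.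
  have be : 1 <= 4 * ktouch * D0 * b0 (f i (h0 p)).
    have := F_lip (f i p) (f i (h0 p)) Fb0; rewrite G2c; last exact: G12.
    rewrite -/D0 => h.
    have : ktouch * b0 (f i p) <= ktouch * (4 * D0 * b0 (f i (h0 p))) by rewrite ler_pM2l.
    by move: nf; rewrite /=; lra.
  have Gpi2 : G2 (f i \o h0) by exact: G12.
  (* For [gamma = f i \o h0], [p1] bounds [c p (gamma (g p)) * b0 (g p)] and [p2] then bounds
     [c (g p) (gamma (g p))]. Both rest on [cb], which keeps [g p] close to the ray from [p]. *)
  have p1 := F_ptolemy p (f i (h0 p)) (f i (h0 (g p))) Fb0.
  rewrite (G2c p (g p) Gpi2 : c (f i (h0 p)) (f i (h0 (g p))) = _) in p1.
  have p2 := F_ptolemy (g p) p (f i (h0 (g p))) Fb0.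
  rewrite (cC (g p) p) in p2.
  have P0' := c_gt0 p (f i (h0 (g p))); have Z0 := c_gt0 (g p) (f i (h0 (g p))).
  have W0 := c_gt0 p (g p); have Q0 := c_gt0 p (f i (h0 p)).
  set P := c p (f i (h0 (g p))) in p1 p2 P0' *.
  set Z := c (g p) (f i (h0 (g p))) in p2 Z0 *.
  set W := c p (g p) in p1 p2 W0 cb *.
  set Q := c p (f i (h0 p)) in D2 p1 Q0 *.
  set e := b0 (g p) in e1 p2 b1 bD cb y0 *.
  set e' := b0 (f i (h0 (g p))) in e1 e1p p1 p2 *.
  set be' := b0 (f i (h0 p)) in be p1 *.
  have q1 : Q * e' <= D * (4 * kexit * e) by apply: ler_pM => //; exact: ltW.
  have q2 : W * b0 p <= W * ktouch by rewrite ler_pM2l.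
  have q3 : e * (P * be') <= e * (2 * (D * (4 * kexit * e) + W * ktouch)).
    by rewrite ler_pM2l//; lra.
  have q4 : e * (e * (4 * kexit * D)) <= 1 * 1 by apply: ler_pM => //; nra.
  have q5 : ktouch * (W * e) <= ktouch * kray by rewrite ler_pM2l.
  have q6 : P * e * be' <= 2 * (1 + kray * ktouch) by lra.
  have q7 : P * e * 1 <= P * e * (4 * ktouch * D0 * be') by rewrite ler_pM2l ?mulr_gt0.
  have q8 : 4 * ktouch * D0 * (P * e * be') <= 4 * ktouch * D0 * (2 * (1 + kray * ktouch)).
    by rewrite ler_pM2l ?mulr_gt0.
  have q9 : P * e <= P0 by rewrite /P0; lra.
  have q10 : W * e' <= W * (4 * kexit * e) by rewrite ler_pM2l.
  have q11 : kexit * (W * e) <= kexit * kray by rewrite ler_pM2l.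
  have q12 : Z * b0 p <= 2 * (4 * kexit * kray + P0) by lra.
  have q13 : Z * 1 <= Z * (ktouch * b0 p) by rewrite ler_pM2l.
  have q14 : ktouch * (Z * b0 p) <= ktouch * (2 * (4 * kexit * kray + P0)).
    by rewrite ler_pM2l.
  by rewrite /M6; lra.
pose phi i := hg \o (f i \o (h0 \o g)).
have phiP : phi @` `I_n.+1 `<=` Phi.
  move=> _ [i hi <-]; split.
    have [[Gf _ _] _] := fK i hi.
    by apply: G2M => //; apply: G2M; [exact: G12|apply: G2M => //; exact: G12].
  by rewrite -(G2c _ _ Gg) /phi/= hgg; exact: move_le.
have phiI : {in `I_n.+1 &, injective phi}.
  move=> i j; rewrite !inE => hi hj ij; apply: fI => //; apply/funext => x.
  have := congr1 (fun u => g (u (hg (k0 x)))) ij.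
  by rewrite /phi/= !hgg !kh.
have := card_le_II n.+1 n; rewrite ltnn => /negbT/negP; apply.
rewrite -(card_le_eqr Pn) -(card_le_eql (inj_card_eq phiI)).
exact: subset_card_le.
Qed.

End Deep.

Lemma coarse_finite_index :
  exists M, forall g, G2 g -> exists2 k, G1 k & c (k p) (g p) <= M.
Proof.
have [[tau [t0 ht]]|h] := pselect (exists tau, 0 < tau /\
    forall b g, F b -> G2 g -> tau <= b (g p)); first exact: bounded_case ht.
exfalso; apply: no_deep => tau t0; apply: contrapT => h'; apply: h.
exists tau; split=> // b g Fb Gg; rewrite leNgt; apply/negP => hb.
by apply: h'; exists b, g.
Qed.

End Coarse.

(** * Disjoint horoballs and exits along chords *)

Section Horoballs.
Context (R : realType) (d : dimension).
Implicit Types (x y z w o p : hyp R d) (xi : bdry R d).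
Implicit Types (g k : hyp R d -> hyp R d).

Lemma cd_ratio_cvg x o xi :
  (fun y => cd x y / cd o y) @ at_bdry xi --> bt xi x / bt xi o.
Proof.
have -> : (fun y => cd x y / cd o y) =
    (fun y => lker x y / lker o y * (hgt o / hgt x)).
  apply/funext => y; rewrite !cdE; have := lker_gt0 y (cball_hyp o).
  have := hgt_gt0 x; have := hgt_gt0 o; have := hgt_gt0 y => hy ho hx l0.
  by field; rewrite !gt_eqF.
have l0 := lker_gt0 o (cball_bdry xi); have hx := hgt_gt0 x; have ho := hgt_gt0 o.
have -> : bt xi x / bt xi o = lker x xi / lker o xi * (hgt o / hgt x).
  by rewrite !btE !(lkerC xi); field; rewrite !gt_eqF// lkerC.
apply: cvgM; last exact: cvg_cst.
apply: cvgM; first exact: lker_cvg.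
by apply: cvgV; [rewrite lkerC gt_eqF|exact: lker_cvg].
Qed.

(** By [cd_ratio_cvg], [bt] is determined up to scale by limits of ratios of [cd], and isometries
    preserve these ratios. *)
Lemma bt_isom o g k xi : (forall x y, cd (g x) (g y) = cd x y) ->
  (forall x y, cd (k x) (k y) = cd x y) -> cancel g k -> cancel k g ->
  exists (xi' : bdry R d) mu, 0 < mu /\ forall x, bt xi (g x) = mu * bt xi' x.
Proof.
move=> ig ik gk kg; have [xi' hxi'] := isom_bdry o xi ik.
have o0 := bt_gt0 xi' o; have go0 := bt_gt0 xi (g o).
exists xi', (bt xi (g o) / bt xi' o); split=> [|x]; first by rewrite divr_gt0.
have c1 := @cd_ratio_cvg (g x) (g o) xi.
have ck : k @ at_bdry xi --> at_bdry xi'.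
  move=> U [e /= e0 eU]; have [r r0 hr] := hxi' e e0.
  by exists r => //= y hy; apply: eU; exact: hr.
have c2 : (fun y => cd x (k y) / cd o (k y)) @ at_bdry xi --> bt xi' x / bt xi' o.
  exact: (cvg_comp k (fun y => cd x y / cd o y) ck (@cd_ratio_cvg x o xi')).
have e : (fun y => cd (g x) y / cd (g o) y) = (fun y => cd x (k y) / cd o (k y)).
  by apply/funext => y; rewrite -[in LHS](kg y) !ig.
rewrite e in c1.
have := cvg_unique (@norm_hausdorff _ _) c1 c2 => h.
have -> : bt xi (g x) = bt xi (g x) / bt xi (g o) * bt xi (g o).
  by rewrite divfK// gt_eqF.
by rewrite h; ring.
Qed.

(** If the bound fails there is a common point: on the geodesic joining the centres when they
    differ, and close to the common centre otherwise. *)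
Lemma horoballs_disjoint xi xi' T T' : 0 < T -> 0 < T' ->
  [set x | bt xi x < T] `&` [set x | bt xi' x < T'] = set0 ->
  2 * T * T' <= lker xi xi'.
Proof.
move=> T0 T0' disj; rewrite leNgt; apply/negP => D1.
suff [w [w1 w2]] : exists w, bt xi w < T /\ bt xi' w < T'.
  by have : set0 w by rewrite -disj.
have lx := bdry_l2 xi; have lx' := bdry_l2 xi'.
have bt_lt (eta : bdry R d) w S : 0 < S ->
    lker eta w ^+ 2 < S ^+ 2 * lker w w -> bt eta w < S.
  move=> S0 h; rewrite btE ltr_pdivrMr ?hgt_gt0//.
  rewrite -(@ltr_pXn2r _ 2) ?nnegrE//; last 2 first.
  - exact/ltW/lker_gt0/cball_bdry.
  - by rewrite mulr_ge0// ltW// hgt_gt0.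
  by rewrite exprMn hgt_sqr.
have D0 : 0 <= lker xi xi'.
  have := dist2_le_lker (cball_bdry xi) (cball_bdry xi').
  have := sqr_ge0 (dist2 xi xi'); lra.
set D := lker xi xi' in D1 D0.
have kxx := lker_bdry xi; have kxx' := lker_bdry xi'.
move: D0; rewrite le_eqVlt => /orP[/eqP D0|D0].
  have e : xi = xi'.
    apply/bdry_inj/funext => i; have lb := in_l2B lx lx'.
    have := dist2_le_lker (cball_bdry xi) (cball_bdry xi').
    rewrite -/D -D0 mulr0 => h0.
    have := sqr_le_dotp i lb; rewrite -(norm2_sqr lb) -/(dist2 xi xi') => h1.
    have : (xi i - xi' i) ^+ 2 = 0.
      by apply/eqP; rewrite eq_le sqr_ge0; apply/andP; split=> //; lra.
    by move/eqP; rewrite sqrf_eq0 subr_eq0 => /eqP.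
  subst xi'.
  pose S := Num.min (Num.min T T') 1.
  have S0 : 0 < S by rewrite !lt_min T0 T0' /=.
  have ST : S <= T by rewrite !ge_min lexx.
  have ST' : S <= T' by rewrite !ge_min lexx !orbT.
  have S1 : S <= 1 by rewrite !ge_min lexx !orbT.
  pose a := S ^+ 2 / 2.
  have a0 : 0 < a by rewrite divr_gt0// exprn_gt0.
  have a1 : a <= 1 / 2 by rewrite /a; nra.
  have l := in_l2_lin (1 - a) 0 lx lx.
  have e1 : dotp xi xi = 1 by rewrite -(norm2_sqr lx) bdry_eq1 expr1n.
  have kw : lker (fun i => (1 - a) * xi i + 0 * xi i) (fun i => (1 - a) * xi i + 0 * xi i)
     = 2 * a - a ^+ 2.
    by rewrite /lker (@dotp_linl R d)// !(@dotp_linr R d)// e1; ring.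
  have [|w wE] := ex_hyp l; first by rewrite kw; nra.
  have h : lker xi w ^+ 2 < S ^+ 2 * lker w w.
    rewrite wE kw /lker (@dotp_linr R d)// e1.
    have -> : S ^+ 2 = 2 * a by rewrite /a; field.
    nra.
  have hb := bt_lt _ _ _ S0 h.
  by exists w; split; [exact: lt_le_trans ST|exact: lt_le_trans ST'].
(* These weights make [bt xi w / T] and [bt xi' w / T'] equal; the square of the common value is
   [D / (2 * T * T')], which is below 1. *)
pose al := T' / (T + T'); pose be := T / (T + T').
have TT : 0 < T + T' by rewrite addr_gt0.
have al0 : 0 < al by rewrite divr_gt0.
have be0 : 0 < be by rewrite divr_gt0.
have ab : al + be = 1 by rewrite /al /be; field; rewrite gt_eqF.
have bE : be = al * (T / T') by rewrite /al /be; field; rewrite !gt_eqF.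
clearbody al be.
have abD : 0 < al * be * D by rewrite mulr_gt0// mulr_gt0.
have l := in_l2_lin al be lx lx'.
have k1 := lker_lin lx lx' lx ab; have k2 := lker_lin lx lx' lx' ab.
have kw := lker_lin lx lx' l ab.
rewrite kxx (lkerC xi' xi) -/D mulr0 add0r lkerC in k1.
rewrite kxx' -/D mulr0 addr0 lkerC in k2.
rewrite k1 k2 in kw.
have [|w wE] := ex_hyp l.
  by rewrite kw; lra.
rewrite -wE in k1 k2 kw.
exists w; split; apply: bt_lt => //.
  rewrite k1 kw bE -subr_gt0.
  have -> : T ^+ 2 * (al * (al * (T / T') * D) + al * (T / T') * (al * D)) -
        (al * (T / T') * D) ^+ 2
     = al ^+ 2 * T ^+ 2 * D / T' ^+ 2 * (2 * T * T' - D) by field; rewrite gt_eqF.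
  by rewrite mulr_gt0 ?subr_gt0// divr_gt0 ?exprn_gt0// !mulr_gt0// exprn_gt0.
rewrite k2 kw bE -subr_gt0.
have -> : T' ^+ 2 * (al * (al * (T / T') * D) + al * (T / T') * (al * D)) - (al * D) ^+ 2
   = al ^+ 2 * D * (2 * T * T' - D) by field; rewrite gt_eqF.
by rewrite mulr_gt0 ?subr_gt0// mulr_gt0// exprn_gt0.
Qed.

Lemma horoballs_disjoint_cd xi xi' (T T' : R) z w : 0 < T -> 0 < T' ->
  [set x | bt xi x < T] `&` [set x | bt xi' x < T'] = set0 ->
  T * T' * cd z w <= bt xi z * bt xi' w + bt xi' z * bt xi w.
Proof.
move=> T0 T0' disj; have h := horoballs_disjoint T0 T0' disj.
have h1 := bt_ptolemy2 xi xi' z w; have c0 := cd_gt0 z w.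
have : 2 * T * T' * cd z w <= lker xi xi' * cd z w by rewrite ler_pM2r.
lra.
Qed.

(* In the Klein model the chord is parametrised affinely, so the position of its
   points relative to a horoball is governed by a concave quadratic. *)
Lemma chord_horoball xi (T : R) y z : 0 < T -> exists a1 a2 a3 : R, a3 <= 0 /\
  forall s, 0 <= s <= 1 -> [/\
    (bt xi (chord y z s) < T) = (0 < a1 + a2 * s + a3 * s ^+ 2) &
    (bt xi (chord y z s) == T) = (a1 + a2 * s + a3 * s ^+ 2 == 0)].
Proof.
move=> T0.
pose A := lker y y; pose B := lker z z; pose D := lker y z.
pose u := lker y xi; pose v := lker z xi.
exists (T ^+ 2 * A - u ^+ 2), (2 * (T ^+ 2 * (D - A) - u * (v - u))),
  (T ^+ 2 * (A + B - 2 * D) - (v - u) ^+ 2); split.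
  have AB : A + B - 2 * D <= 0.
    have := dist2_sqr (hyp_l2 y) (hyp_l2 z); have := sqr_ge0 (dist2 y z).
    by rewrite /A /B /D /lker; lra.
  have := sqr_ge0 (v - u); have : T ^+ 2 * (A + B - 2 * D) <= 0.
    by rewrite mulr_ge0_le0// sqr_ge0.
  lra.
move=> s hs; set x := chord y z s.
set q := _ + _ + _.
have qE : q = T ^+ 2 * lker x x - lker xi x ^+ 2.
  rewrite (lkerC xi) /x lker_chord2// lker_chord//; last exact: bdry_l2.
  by rewrite /q -/A -/B -/D -/u -/v; ring.
have x0 := hgt_gt0 x; have b0 := bt_gt0 xi x.
have {}qE : q = hgt x ^+ 2 * (T + bt xi x) * (T - bt xi x).
  by rewrite qE -hgt_sqr lker_bt; ring.
have p : 0 < hgt x ^+ 2 * (T + bt xi x) by rewrite mulr_gt0 ?exprn_gt0// addr_gt0.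
rewrite qE pmulr_rgt0// subr_gt0 mulf_eq0 (gt_eqF p) subr_eq0 orFb; split=> //.
Qed.

Lemma quad_root (a1 a2 a3 : R) : 0 < a1 -> a1 + a2 + a3 <= 0 ->
  exists2 s, 0 <= s <= 1 & a1 + a2 * s + a3 * s ^+ 2 = 0.
Proof.
move=> h0 h1; pose P : {poly R} := - (a1%:P + a2 *: 'X + a3 *: 'X^2).
have PE s : P.[s] = - (a1 + a2 * s + a3 * s ^+ 2) by rewrite /P !hornerE.
have [||s hs /rootP] := @poly_ivt _ P 0 1; first exact: ler01.
  by rewrite !PE; apply/andP; split; lra.
by rewrite PE => /eqP; rewrite oppr_eq0 => /eqP; exists s.
Qed.

End Horoballs.

(** * From geometric finiteness to the coarse model, and cosets *)

Section Commensurability.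
Context (R : realType) (d : dimension).
Implicit Types (x y z w o p : hyp R d) (xi : bdry R d).
Implicit Types (g k : hyp R d -> hyp R d) (G : set (hyp R d -> hyp R d)).

Lemma strongly_discrete_cd o p G (M : R) :
  (forall g, G g -> forall x y, cd (g x) (g y) = cd x y) ->
  strongly_discrete o G -> finite_set [set g | G g /\ cd p (g p) <= M].
Proof.
move=> iG sd; pose M' := 16 * cd o p ^+ 2 * `|M| + 1.
have M'0 : 0 <= 16 * cd o p ^+ 2 * `|M| by rewrite mulr_ge0// mulr_ge0// sqr_ge0.
have l0 : 0 < ln (2 * M') by rewrite ln_gt0// /M'; lra.
apply: sub_finite_set (sd _ l0) => g [Gg cM]; split=> //.
apply: hdist_le_cd; rewrite /M'.
have t1 := cd_tri o p (g o); have t2 := cd_tri p (g p) (g o).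
rewrite (iG g Gg) (cdC p o) in t2.
have c0 := cd_gt0 o p.
have t3 : 4 * cd o p * cd p (g o) <= 4 * cd o p * (4 * cd p (g p) * cd o p).
  by rewrite ler_pM2l// mulr_gt0.
have t4 : cd o p ^+ 2 * cd p (g p) <= cd o p ^+ 2 * `|M|.
  by rewrite ler_pM2l ?exprn_gt0//; apply: le_trans cM (ler_norm _).
lra.
Qed.

Definition horofun (HH : set (set (hyp R d))) : set (hyp R d -> R) :=
  [set b | exists xi T, [/\ 0 < T, b = (fun x => bt xi x / T) &
                          HH [set x | bt xi x < T]]].

Lemma horofun_lt1 (xi : bdry R d) (T : R) : 0 < T ->
  [set x | bt xi x / T < 1] = [set x | bt xi x < T].
Proof. by move=> T0; apply/seteqP; split=> x /=; rewrite ltr_pdivrMr// mul1r. Qed.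

Section Cover.
Context (HH : set (set (hyp R d))) (C : set (hyp R d)) (G : set (hyp R d -> hyp R d)).
Context (o p : hyp R d) (sigma : R).
Hypothesis isoG : isometry_group G.
Hypothesis horoHH : HH `<=` horoball o.
Hypothesis disjHH : trivIset HH id.
Hypothesis invHH : forall g B, G g -> HH B -> HH (g @` B).
Hypothesis coverC : C `<=` (\bigcup_(g in G) (g @` hball o sigma)) `|`
               (\bigcup_(B in HH) B).
Hypothesis cvC : hconvex C.

(** The 4 comes from [cd_tri] and [expR sigma] bounds the cosh of a distance below [sigma]; the
    [+ 1] ensures [1 <= s0]. *)
Local Notation s0 := (4 * expR sigma * cd o p + 1).

Lemma horofun_gt0 b x : horofun HH b -> 0 < b x.
Proof. by move=> [xi [T [T0 -> _]]]; rewrite divr_gt0// bt_gt0. Qed.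

Lemma horofun_ptolemy b x y z : horofun HH b ->
  cd x z * b y <= 2 * (cd x y * b z + cd y z * b x).
Proof.
move=> [xi [T [T0 -> _]]]; have := bt_ptolemy xi x y z => h.
rewrite -(ler_pM2r T0).
have -> : cd x z * (bt xi y / T) * T = cd x z * bt xi y by field; rewrite gt_eqF.
have -> : 2 * (cd x y * (bt xi z / T) + cd y z * (bt xi x / T)) * T =
  2 * (cd x y * bt xi z + cd y z * bt xi x) by field; rewrite gt_eqF.
exact: h.
Qed.

Lemma horofun_isom b k : horofun HH b -> G k -> horofun HH (b \o k).
Proof.
have [isG _ _ GV] := isoG.
move=> [xi [T [T0 -> HB]]] Gk; have [h [Gh kh hk]] := GV k Gk.
have ik := isom_cd (isG k Gk); have ih := isom_cd (isG h Gh).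
have [xi' [mu [mu0 bE]]] := bt_isom o xi ik ih kh hk.
exists xi', (T / mu); split; first by rewrite divr_gt0.
  by apply/funext => x /=; rewrite bE; field; rewrite !gt_eqF.
have -> : [set x | bt xi' x < T / mu] = h @` [set x | bt xi x < T].
  apply/seteqP; split=> x /=.
    rewrite ltr_pdivlMr// mulrC -bE => hx; exists (k x) => //.
  by move=> [y hy <-]; rewrite ltr_pdivlMr// mulrC -bE hk.
exact: invHH.
Qed.

Lemma horofun_disjoint b b' : horofun HH b -> horofun HH b' ->
  [set x | b x < 1] = [set x | b' x < 1] \/
  forall z w, cd z w <= b z * b' w + b' z * b w.
Proof.
move=> [xi [T [T0 -> HB]]] [xi' [T' [T0' -> HB']]].
rewrite !horofun_lt1//.
have [->|ne] := pselect ([set x | bt xi x < T] = [set x | bt xi' x < T']).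
  by left.
right=> z w; have disj : [set x | bt xi x < T] `&` [set x | bt xi' x < T'] = set0.
  by apply: contrapT => /eqP/set0P h; apply: ne; exact: disjHH.
have h := horoballs_disjoint_cd z w T0 T0' disj.
have TT : 0 < T * T' by rewrite mulr_gt0.
rewrite -(ler_pM2l TT).
have -> : T * T' * (bt xi z / T * (bt xi' w / T') + bt xi' z / T' * (bt xi w / T)) =
  bt xi z * bt xi' w + bt xi' z * bt xi w by field; rewrite !gt_eqF.
exact: h.
Qed.

Lemma near_orbit x : (\bigcup_(g in G) (g @` hball o sigma)) x ->
  exists2 k, G k & cd x (k p) <= s0.
Proof.
have [isG _ _ _] := isoG.
move=> [k Gk [y hy <-]]; exists k => //.
rewrite (isom_cd (isG k Gk)); have := cd_tri y o p.
have := cd_lt_expR hy; rewrite (cdC y o) => h1 h2.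
have c0 := cd_gt0 o p.
have : cd o y * cd o p <= expR sigma * cd o p by rewrite ler_pM2r// ltW.
lra.
Qed.

Lemma horofun_cover x : C x ->
  (exists2 k, G k & cd x (k p) <= s0) \/ (exists2 b, horofun HH b & b x < 1).
Proof.
move=> /coverC[/near_orbit|[B HB Bx]]; first by left.
right; have [xi [T [T0 BE]]] := horoball_bt (horoHH HB); subst B.
exists (fun x => bt xi x / T); first by exists xi, T.
by rewrite ltr_pdivrMr// mul1r.
Qed.

(* A point of a geodesic where it leaves an open horoball lies in no other
   horoball of the disjoint family. *)
Lemma horofun_exit b y z : horofun HH b -> C y -> C z -> b y < 1 -> 1 <= b z ->
  exists x k, [/\ C x, G k, b x = 1, cd y x * cd x z <= cd y z & cd x (k p) <= s0].
Proof.
move=> [xi [T [T0 -> HB]]] Cy Cz; rewrite ltr_pdivrMr// ler_pdivlMr// mul1r => by1 bz1.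
have [a1 [a2 [a3 [a30 aE]]]] := chord_horoball xi y z T0.
have h01 : 0 <= (0 : R) <= 1 by rewrite lexx ler01.
have h11 : 0 <= (1 : R) <= 1 by rewrite lexx ler01.
have a0 : 0 < a1.
  have [h _] := aE 0 h01; rewrite chord0 by1 in h.
  by move/esym: h; rewrite mulr0 expr0n/= mulr0 !addr0.
have a123 : a1 + a2 + a3 <= 0.
  have [h _] := aE 1 h11; rewrite chord1 in h.
  by move: bz1; rewrite leNgt h mulr1 expr1n mulr1 -leNgt.
have [s hs sE] := quad_root a0 a123.
have [_ bs] := aE s hs; rewrite sE eqxx in bs; move/eqP: bs => bs.
pose x := chord y z s; have Cx : C x by exact: hconvex_chord.
have [x_orb|[B HB' Bx]] := coverC Cx.
  have [k Gk ck] := near_orbit x_orb.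
  exists x, k; split=> //; first by rewrite bs divff// gt_eqF.
  exact: cd_chord.
exfalso; have [xi' [T' [T0' BE]]] := horoball_bt (horoHH HB'); subst B.
have [e1 [e2 [e3 [e30 eE]]]] := chord_horoball xi' y z T0'.
have m0 : 0 < e1 + e2 * s + e3 * s ^+ 2 by have [<- _] := eE s hs.
set m := e1 + e2 * s + e3 * s ^+ 2 in m0.
(* Backing up from [s] to [(1 - t) * s] enters the first horoball, since its concave quadratic is
   positive at 0 and zero at [s]. This [t] keeps the second quadratic at least [m / 2], so the two
   horoballs would meet. *)
pose t := m / (2 * (m + `|e1|)).
have me0 : 0 < m + `|e1| by apply: ltr_pwDl.
have tE : t * (m + `|e1|) = m / 2 by rewrite /t; field; rewrite gt_eqF.
have t0 : 0 < t by rewrite divr_gt0// mulr_gt0.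
have t1 : t <= 1 / 2.
  rewrite /t ler_pdivrMr ?mulr_gt0//; have := normr_ge0 e1; lra.
have /andP[s0' s1'] := hs; clearbody t.
have ts0 : 0 <= t * s by rewrite mulr_ge0// ltW.
have hs' : 0 <= (1 - t) * s <= 1.
  by apply/andP; split; [rewrite mulr_ge0//; lra|lra].
have conc q1 q2 q3 : q3 <= 0 ->
    (1 - t) * (q1 + q2 * s + q3 * s ^+ 2) + t * q1 <=
    q1 + q2 * ((1 - t) * s) + q3 * ((1 - t) * s) ^+ 2.
  move=> q30; have : 0 <= (t * (1 - t)) * (s ^+ 2 * (- q3)).
    by rewrite !mulr_ge0 ?sqr_ge0//; lra.
  lra.
have b1 : bt xi (chord y z ((1 - t) * s)) < T.
  have [-> _] := aE _ hs'; apply: lt_le_trans (conc _ _ _ a30).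
  by rewrite sE mulr0 add0r mulr_gt0.
have b2 : bt xi' (chord y z ((1 - t) * s)) < T'.
  have [-> _] := eE _ hs'; apply: lt_le_trans (conc _ _ _ e30).
  rewrite -/m; have := ler_norm (- e1); rewrite normrN => n1.
  have : t * (- e1) <= t * `|e1| by rewrite ler_pM2l.
  lra.
have E : [set x | bt xi x < T] = [set x | bt xi' x < T'].
  by apply: disjHH => //; exists (chord y z ((1 - t) * s)).
have : [set x | bt xi x < T] x by rewrite E.
by rewrite /= bs ltxx.
Qed.

End Cover.

(** Three limit points are taken because one direction may run towards the centre of a given
    horoball, and two must remain to produce a pair of exits. *)
Lemma hull_directions p (L : set (bdry R d)) (C : set (hyp R d)) :
  L `<=` bdry_closure C -> (exists xi eta zeta : bdry R d, [/\ L xi, L eta & L zeta] /\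
    [/\ xi <> eta, xi <> zeta & eta <> zeta]) ->
  exists (A : 'I_3 -> set (hyp R d)) (delta : R), [/\ 0 < delta,
    (forall i, A i `<=` C),
    (forall i M, exists2 x, A i x & M <= cd p x) &
    (forall i j x y, i != j -> A i x -> A j y ->
      delta * (cd p x * cd p y) <= cd x y)].
Proof.
move=> LC [xi [eta [zeta [[Lx Le Lz] [xe xz ez]]]]].
have [e1 [d1 [e10 d10 h1]]] := near_bdry_apart p xe.
have [e2 [d2 [e20 d20 h2]]] := near_bdry_apart p xz.
have [e3 [d3 [e30 d30 h3]]] := near_bdry_apart p ez.
pose e := Num.min e1 (Num.min e2 e3); pose delta := Num.min d1 (Num.min d2 d3).
have e0 : 0 < e by rewrite !lt_min e10 e20.
have d0 : 0 < delta by rewrite !lt_min d10 d20.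
have [le1 le2 le3] : [/\ e <= e1, e <= e2 & e <= e3].
  by rewrite /e !ge_min !lexx !orbT.
have [ld1 ld2 ld3] : [/\ delta <= d1, delta <= d2 & delta <= d3].
  by rewrite /delta !ge_min !lexx !orbT.
pose P := fun i : 'I_3 => nth xi [:: xi; eta; zeta] i.
have LP i : L (P i) by case: i => [[|[|[|//]]] hi].
exists (fun i => [set x | C x /\ dist2 x (P i) < e]), delta; split=> //.
- by move=> i x [].
- move=> i M; have [r r0 hr] := near_bdry_far p (P i) M.
  have [|x [Cx hx]] := LC _ (LP i) [set x | dist2 x (P i) < Num.min e r].
    by exists (Num.min e r) => //=; rewrite lt_min e0.
  move: hx => /=; rewrite lt_min => /andP[x1 x2].
  by exists x => //; exact: hr.
- have key a b x y (d' : R) : delta <= d' -> d' * (cd p x * cd p y) <= cd x y ->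
      a = cd x y -> b = cd p x * cd p y -> delta * b <= a.
    move=> dd hd -> ->; apply: le_trans hd; rewrite ler_pM2r// mulr_gt0//; exact: cd_gt0.
  have swap x y : cd p x * cd p y = cd p y * cd p x by exact: mulrC.
  move=> [[|[|[|//]]] hi] [[|[|[|//]]] hj] x y // _ [_ hx] [_ hy].
  + by apply: (key _ _ x y d1) => //; apply: h1;
      [exact: lt_le_trans hx _|exact: lt_le_trans hy _].
  + by apply: (key _ _ x y d2) => //; apply: h2;
      [exact: lt_le_trans hx _|exact: lt_le_trans hy _].
  + apply: (key _ _ y x d1) => //; last exact: cdC; apply: h1.
      exact: lt_le_trans hy _.
    exact: lt_le_trans hx _.
  + by apply: (key _ _ x y d3) => //; apply: h3;
      [exact: lt_le_trans hx _|exact: lt_le_trans hy _].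
  + apply: (key _ _ y x d2) => //; last exact: cdC; apply: h2.
      exact: lt_le_trans hy _.
    exact: lt_le_trans hx _.
  + apply: (key _ _ y x d3) => //; last exact: cdC; apply: h3.
      exact: lt_le_trans hy _.
    exact: lt_le_trans hx _.
Qed.

(** Nearness applied to the inverse of [g] gives [k] in [G1] such that [g \o k] moves [p] by at most
    [M]; so every coset of [G1] has a representative in a finite set. *)
Lemma commensurable_sub p G1 G2 (M : R) :
  isometry_group G1 -> isometry_group G2 -> G1 `<=` G2 ->
  (forall N : R, finite_set [set g | G2 g /\ cd p (g p) <= N]) ->
  (forall g, G2 g -> exists2 k, G1 k & cd (k p) (g p) <= M) ->
  commensurable G1 G2.
Proof.
move=> [_ _ M1 V1] [iso2 _ M2 V2] G12 disc near.
have cosetE k : G1 k -> [set k \o h | h in G1] = G1.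
  move=> Gk; apply/seteqP; split=> [_ [h Gh <-]|h Gh]; first exact: M1.
  have [k' [Gk' kk' k'k]] := V1 k Gk; exists (k' \o h); first exact: M1.
  by apply/funext => x /=; rewrite k'k.
have G1I : G1 `&` G2 = G1 by exact/setIidPl.
rewrite /commensurable G1I; split.
  apply: (@sub_finite_set _ _ [set G1]); last exact: finite_set1.
  by move=> _ [k Gk <-]; exact: cosetE.
apply: (@sub_finite_set _ _ ((fun f => [set f \o h | h in G1]) @`
    [set f | G2 f /\ cd p (f p) <= M])); last exact: finite_image.
move=> _ [g Gg <-]; have [g' [Gg' gg' g'g]] := V2 g Gg.
have [k Gk ck] := near g' Gg'; have [k' [Gk' kk' k'k]] := V1 k Gk.
exists (g \o k).
  split; first by apply: M2 => //; exact: G12.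
  by rewrite /= -(isom_cd (iso2 _ Gg')) gg' cdC.
apply/seteqP; split=> _ [h Gh <-].
  by exists (k \o h) => //; exact: M1.
by exists (k' \o h); [exact: M1|apply/funext => x /=; rewrite k'k].
Qed.

End Commensurability.

Theorem theorem4p1 (R : realType) (d : dimension) (hd : dim_ge d 2)
    (o : hyp R d) (G1 G2 : set (hyp R d -> hyp R d))
    (hG1 : isometry_group G1) (hG2 : isometry_group G2)
    (sdG1 : strongly_discrete o G1) (sdG2 : strongly_discrete o G2)
    (hL : limit_set o G1 = limit_set o G2)
    (neG1 : nonelementary o G1) (gfG1 : geometrically_finite o G1)
    (hsub : G1 `<=` G2) :
  commensurable G1 G2.
Proof.
have [C hullC [HH [sigma [horoHH disjHH invHH sigma0 coverC]]]] := gfG1.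
have [_ cvC LC _] := hullC.
have [_ _ M1 V1] := hG1; have [iso2 _ M2 V2] := hG2.
have cd2 g x y : G2 g -> cd (g x) (g y) = cd x y.
  by move=> Gg; exact: isom_cd (iso2 g Gg) x y.
have hull2 : is_convex_hull (limit_set o G2) C by rewrite -hL.
have CG g x : G2 g -> C x -> C (g x).
  by move=> Gg; exact: convex_hull_invariant hG2 hull2 Gg x.
have [p Cp] : exists p, C p.
  have [xi [_ [_ [[Lxi _ _] _]]]] := neG1.
  have [|p [Cp _]] := LC _ Lxi setT; last by exists p.
  exact: filterT.
have disc N : finite_set [set g | G2 g /\ cd p (g p) <= N].
  by apply: strongly_discrete_cd sdG2 => g Gg x y; exact: cd2.
have [A [delta [delta0 AC A_far A_sep]]] := hull_directions p LC neG1.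
have s01 : 1 <= 4 * expR sigma * cd o p + 1.
  by rewrite lerDr !mulr_ge0// ?expR_ge0// ltW// cd_gt0.
have [M hM] := coarse_finite_index (@cdC R d) (@cdxx R d) (@cd_ge1 R d)
  (@cd_ptolemy R d) Cp M1 V1 M2 V2 hsub cd2 CG disc (@horofun_gt0 R d HH)
  (@horofun_ptolemy R d HH) (horofun_isom o hG1 invHH) (horofun_disjoint disjHH) s01
  (horofun_exit p hG1 horoHH disjHH coverC cvC) (horofun_cover p hG1 horoHH coverC)
  delta0 AC A_far A_sep.
exact: commensurable_sub hG1 hG2 hsub disc hM.
Qed.
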